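(* Let $\Gamma$ be a finite simplicial graph and let $\{G_v\}_{v\in V(\Gamma)}$ be a collection of finitely generated groups such that each $G_v$ has the weak Haagerup property with weak Haagerup constant $\Lambda_{WH}(G_v)=1$. Then the graph product $G(\Gamma)$ has the weak Haagerup property, and moreover $\Lambda_{WH}(G(\Gamma))=1$.
   Context: All groups are discrete. For a group $G$ and a function $\phi:G\to\mathbb{C}$, the $B_2$-norm (completely bounded Herz–Schur multiplier norm) $\|\phi\|_{B_2}$ is the norm $\sup_{n}\|M_{n,\phi}\|$, where $m_\phi:\mathbb{B}(\ell^2(G))\to\mathbb{B}(\ell^2(G))$ is the Schur multiplier $[A_{g,h}]\mapsto[\phi(h^{-1}g)A_{g,h}]$ and $M_{n,\phi}$ is its $n$-fold amplification to $\mathbb{M}_n(\mathbb{B}(\ell^2(G)))$; equivalently, $\|\phi\|_{B_2}$ is the infimum of $\|\alpha\|_\infty\|\beta\|_\infty$ over all Hilbert spaces $\mathcal{H}$ and bounded maps $\alpha,\beta:G\to\mathcal{H}$ with $\phi(h^{-1}g)=\langle\alpha(g),\beta(h)\rangle$ for all $g,h\in G$ (and $\infty$ if no such factorization exists). A function $\phi:G\to\mathbb{C}$ vanishes at infinity if for every $\varepsilon>0$ the set $\{g\in G: |\phi(g)|\ge\varepsilon\}$ is finite. A group $G$ has the weak Haagerup property if there exist a constant $B>0$ and a sequence $\phi_n:G\to\mathbb{C}$ such that each $\phi_n$ vanishes at infinity, $\phi_n(g)\to1$ for every $g\in G$, and $\|\phi_n\|_{B_2}\le B$ for all $n$; the weak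 Haagerup constant $\Lambda_{WH}(G)$ is the infimum of all such $B$. Given a finite simplicial graph $\Gamma$ (no loops, no multiple edges) with vertex set $V(\Gamma)$ and edge set $E(\Gamma)$, and groups $G_v$ indexed by $V(\Gamma)$, the graph product is $G(\Gamma)=\big(\ast_{v\in V(\Gamma)}G_v\big)/\langle\langle\{[g_v,g_w]: g_v\in G_v,\ g_w\in G_w,\ [v,w]\in E(\Gamma)\}\rangle\rangle$, i.e. the free product of the $G_v$ modulo the relations that $G_v$ and $G_w$ commute whenever $v,w$ are adjacent. *)

(* Defs.v *)
From Stdlib Require Import Reals List.
From Coquelicot Require Import Coquelicot.
Open Scope R_scope.

Record group := Group {
  gcar :> Type;
  gmul : gcar -> gcar -> gcar;
  gone : gcar;
  ginv : gcar -> gcar;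
  gmulA : forall x y z, gmul x (gmul y z) = gmul (gmul x y) z;
  gmul1l : forall x, gmul gone x = x;
  gmul1r : forall x, gmul x gone = x;
  gmulVl : forall x, gmul (ginv x) x = gone;
  gmulVr : forall x, gmul x (ginv x) = gone }.

Definition is_hom (G H : group) (f : G -> H) : Prop :=
  forall x y : G, f (gmul G x y) = gmul H (f x) (f y).

Fixpoint eval_word (G : group) (w : list (bool * G)) : G :=
  match w with
  | nil => gone G
  | (b, s) :: w' => gmul G (if b then ginv G s else s) (eval_word G w')
  end.

Definition finitely_generated (G : group) : Prop :=
  exists S : list G, forall g : G,
    exists w : list (bool * G), (forall p, In p w -> In (snd p) S) /\ g = eval_word G w.

Definition finite_type (V : Type) : Prop := exists l : list V, forall v, In v l.
Definition simplicial (V : Type) (adj : V -> V -> Prop) : Prop :=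
  (forall v w, adj v w -> adj w v) /\ (forall v, ~ adj v v).

Definition compatible_family (V : Type) (adj : V -> V -> Prop) (Gs : V -> group)
  (K : group) (f : forall v, Gs v -> K) : Prop :=
  (forall v, is_hom (Gs v) K (f v)) /\
  (forall v w (a : Gs v) (b : Gs w), adj v w ->
      gmul K (f v a) (f w b) = gmul K (f w b) (f v a)).

(* P (with the maps iota_v) is the graph product G(Gamma): the free product of
   the G_v modulo the commutation relations [g_v, g_w] for adjacent v, w,
   characterised by its universal property. *)
Definition is_graph_product (V : Type) (adj : V -> V -> Prop) (Gs : V -> group)
  (P : group) (iota : forall v, Gs v -> P) : Prop :=
  compatible_family V adj Gs P iota /\
  forall (K : group) (f : forall v, Gs v -> K),
    compatible_family V adj Gs K f ->
    (exists F : P -> K, is_hom P K F /\ forall v a, F (iota v a) = f v a) /\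
    (forall F1 F2 : P -> K, is_hom P K F1 -> is_hom P K F2 ->
       (forall v a, F1 (iota v a) = f v a) -> (forall v a, F2 (iota v a) = f v a) ->
       forall x, F1 x = F2 x).

Record hilbert := Hilbert {
  hcar :> Type;
  hzero : hcar;
  hadd : hcar -> hcar -> hcar;
  hopp : hcar -> hcar;
  hscal : C -> hcar -> hcar;
  hinner : hcar -> hcar -> C;
  haddA : forall x y z, hadd x (hadd y z) = hadd (hadd x y) z;
  haddC : forall x y, hadd x y = hadd y x;
  hadd0 : forall x, hadd hzero x = x;
  haddN : forall x, hadd x (hopp x) = hzero;
  hscalDr : forall a x y, hscal a (hadd x y) = hadd (hscal a x) (hscal a y);
  hscalDl : forall a b x, hscal (Cplus a b) x = hadd (hscal a x) (hscal b x);
  hscalA : forall a b x, hscal (Cmult a b) x = hscal a (hscal b x);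
  hscal1 : forall x, hscal (RtoC 1) x = x;
  hinnerDl : forall x y z, hinner (hadd x y) z = Cplus (hinner x z) (hinner y z);
  hinnerZl : forall a x y, hinner (hscal a x) y = Cmult a (hinner x y);
  hinner_sym : forall x y, hinner y x = Cconj (hinner x y);
  hinner_pos : forall x, Im (hinner x x) = 0 /\ 0 <= Re (hinner x x);
  hinner_def : forall x, hinner x x = RtoC 0 -> x = hzero;
  hcomplete : forall u : nat -> hcar,
    (forall eps, 0 < eps -> exists N, forall m n, (N <= m)%nat -> (N <= n)%nat ->
        sqrt (Re (hinner (hadd (u m) (hopp (u n))) (hadd (u m) (hopp (u n))))) < eps) ->
    exists l, forall eps, 0 < eps -> exists N, forall n, (N <= n)%nat ->
        sqrt (Re (hinner (hadd (u n) (hopp l)) (hadd (u n) (hopp l)))) < eps }.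

Definition hnorm (H : hilbert) (x : H) : R := sqrt (Re (hinner H x x)).

(* B2_le G phi B  <->  ||phi||_{B_2} <= B, where ||phi||_{B_2} is the infimum of
   ||alpha||_oo ||beta||_oo over all Hilbert spaces H and bounded maps
   alpha, beta : G -> H with phi(h^-1 g) = <alpha g, beta h>. *)
Definition B2_le (G : group) (phi : G -> C) (B : R) : Prop :=
  forall eps, 0 < eps ->
  exists (H : hilbert) (alpha beta : G -> H) (Ma Mb : R),
    (forall g, hnorm H (alpha g) <= Ma) /\
    (forall h, hnorm H (beta h) <= Mb) /\
    Ma * Mb <= B + eps /\
    (forall g h : G, phi (gmul G (ginv G h) g) = hinner H (alpha g) (beta h)).

Definition vanishes_at_infinity (G : group) (phi : G -> C) : Prop :=
  forall eps, 0 < eps -> exists l : list G, forall g, eps <= Cmod (phi g) -> In g l.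

Definition WH_constant (G : group) (B : R) : Prop :=
  0 < B /\
  exists phi : nat -> G -> C,
    (forall n, vanishes_at_infinity G (phi n)) /\
    (forall g, forall eps, 0 < eps -> exists N, forall n, (N <= n)%nat ->
        Cmod (Cplus (phi n g) (Copp (RtoC 1))) < eps) /\
    (forall n, B2_le G (phi n) B).

Definition weak_Haagerup (G : group) : Prop := exists B, WH_constant G B.

Definition Lambda_WH_eq (G : group) (c : R) : Prop :=
  (forall B, WH_constant G B -> c <= B) /\
  (forall d, (forall B, WH_constant G B -> d <= B) -> d <= c) /\
  weak_Haagerup G.

(* Main.v *)
Require Import Defs.
From Stdlib Require Import Reals List Lra Lia Classical ClassicalEpsilon.
From Stdlib Require Import FunctionalExtensionality ProofIrrelevance Cantor.
From Coquelicot Require Import Coquelicot.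
Import ListNotations.
Open Scope C_scope.

(* Multipliers of the vertex groups with B_2-norm close to 1 are turned into
   functions [psi] with [psi 1 = 1] and [|psi| <= t < 1] elsewhere, whose centred
   kernel [psi (y^-1 x) - psi x * psi (y^-1)] equals [<a x, b y>] with
   [|a x|^2 <= (1 - |psi x|^2) (1 + theta)]; this is possible because in a
   factorization [phi (y^-1 x) = <alpha x, beta y>] with norms close to 1 and
   [phi 1 = 1] the vectors [alpha 1] and [beta 1] almost coincide.

   The multiplier of the graph product sends a reduced word to the product of the
   values of the [psi_v] on its syllables.  It is the pointwise product over the
   vertices [v] of the functions that only see the [v]-syllables, so, passing to
   tensor products, one vertex can be treated at a time.  For fixed [v] the
   [v]-syllables of [g] form a word in the free product of copies of [G_v] indexed
   by the cosets of the subgroup of the link of [v], on which the graph product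
   acts.  For a word [s = s_1 ... s_n] the vectors [a (s_k)], placed at the
   prefix [s_1 ... s_(k-1)] and weighted by [psi (s_(k+1)) ... psi (s_n)], give a
   factorization of the kernel: inner products and norms both telescope, and the
   norms stay below [1 + theta].  Multiplication by [v]-letters and translation of
   the cosets preserve the kernel, so it is left invariant.

   Reduced words are words of minimal length, hence no normal form theorem is
   needed: in a word of minimal length, two [v]-letters separated by an element of
   the link subgroup could be merged. *)

(** * Complex conjugation and the Kronecker delta *)

Lemma conj_RtoC (x : R) : Cconj (RtoC x) = RtoC x.
Proof. unfold Cconj, RtoC; simpl; now rewrite Ropp_0. Qed.

Lemma mul_conj_RtoC (c : C) : c * Cconj c = RtoC (Cmod c * Cmod c)%R.
Proof. rewrite <- Cmod2_conj. f_equal. ring. Qed.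

Definition delta {I : Type} (i j : I) : C :=
  if excluded_middle_informative (i = j) then RtoC 1 else RtoC 0.

Lemma delta_eq {I : Type} (i : I) : delta i i = RtoC 1.
Proof. unfold delta; destruct excluded_middle_informative; congruence. Qed.

Lemma delta_neq {I : Type} (i j : I) : i <> j -> delta i j = RtoC 0.
Proof. unfold delta; destruct excluded_middle_informative; congruence. Qed.

Lemma delta_conj {I : Type} (i j : I) : Cconj (delta i j) = delta i j.
Proof. unfold delta; destruct excluded_middle_informative; apply conj_RtoC. Qed.

Lemma delta_pair {I J : Type} (i i' : I) (j j' : J) :
  delta (i, j) (i', j') = delta i i' * delta j j'.
Proof.
  unfold delta; repeat destruct excluded_middle_informative; try congruence; ring.
Qed.

(** * Formal finite linear combinations *)

(* The same index may occur several times; [vdot] treats the list as a formal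
   sum, so no normalisation is ever needed. *)
Definition vec (I : Type) := list (C * I).

(** The inner product of the basis vector at [i] with [y]. The conjugate is taken here, so that
    [vdot] is linear in its first argument, as [hinner] is. *)
Fixpoint vcoef {I : Type} (y : vec I) (i : I) : C :=
  match y with
  | [] => RtoC 0
  | (d, j) :: y' => Cconj d * delta i j + vcoef y' i
  end.

Fixpoint vdot {I : Type} (x y : vec I) : C :=
  match x with
  | [] => RtoC 0
  | (c, i) :: x' => c * vcoef y i + vdot x' y
  end.

Definition vscal {I : Type} (k : C) (x : vec I) : vec I :=
  map (fun p => (k * fst p, snd p)) x.

Definition vmap {I J : Type} (f : I -> J) (x : vec I) : vec J :=
  map (fun p => (fst p, f (snd p))) x.

Fixpoint vtens {I J : Type} (x : vec I) (y : vec J) : vec (I * J) :=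
  match x with
  | [] => []
  | (c, i) :: x' => vmap (pair i) (vscal c y) ++ vtens x' y
  end.

Lemma vscal_cons {I : Type} k c (i : I) x : vscal k ((c, i) :: x) = (k * c, i) :: vscal k x.
Proof. reflexivity. Qed.

Lemma vmap_cons {I J : Type} (f : I -> J) c i x :
  vmap f ((c, i) :: x) = (c, f i) :: vmap f x.
Proof. reflexivity. Qed.

Lemma vcoef_app {I : Type} (x y : vec I) i : vcoef (x ++ y) i = vcoef x i + vcoef y i.
Proof. induction x as [|[c j] x IH]; simpl; [|rewrite IH]; ring. Qed.

Lemma vdot_app_l {I : Type} (x x' y : vec I) : vdot (x ++ x') y = vdot x y + vdot x' y.
Proof. induction x as [|[c j] x IH]; simpl; [|rewrite IH]; ring. Qed.

Lemma vdot_app_r {I : Type} (x y y' : vec I) : vdot x (y ++ y') = vdot x y + vdot x y'.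
Proof.
  induction x as [|[c j] x IH]; simpl; [|rewrite IH, vcoef_app]; ring.
Qed.

Lemma vdot_nil_r {I : Type} (x : vec I) : vdot x [] = RtoC 0.
Proof. induction x as [|[c j] x IH]; simpl; [|rewrite IH]; ring. Qed.

Lemma vdot_scal_l {I : Type} k (x y : vec I) : vdot (vscal k x) y = k * vdot x y.
Proof.
  induction x as [|[c j] x IH]; [|rewrite vscal_cons; cbn [vdot]; rewrite IH]; simpl; ring.
Qed.

Lemma vcoef_scal {I : Type} k (y : vec I) i : vcoef (vscal k y) i = Cconj k * vcoef y i.
Proof.
  induction y as [|[c j] y IH]; [|rewrite vscal_cons; cbn [vcoef]; rewrite IH, Cmult_conj]; simpl; ring.
Qed.

Lemma vdot_scal_r {I : Type} k (x y : vec I) : vdot x (vscal k y) = Cconj k * vdot x y.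
Proof. induction x as [|[c j] x IH]; simpl; [|rewrite IH, vcoef_scal]; ring. Qed.

Lemma vdot_sym {I : Type} (x y : vec I) : vdot y x = Cconj (vdot x y).
Proof.
  assert (E : forall d j, vdot x [(d, j)] = Cconj (d * vcoef x j)).
  { intros d j. induction x as [|[c i] x IH]; simpl.
    - rewrite Cmult_0_r. now rewrite conj_RtoC.
    - rewrite IH. unfold delta.
      rewrite !Cmult_conj, !Cplus_conj, Cmult_conj, Cconj_conj.
      repeat destruct excluded_middle_informative; try congruence; rewrite conj_RtoC; ring. }
  induction y as [|[d j] y IH]; simpl.
  - now rewrite vdot_nil_r, conj_RtoC.
  - change ((d, j) :: y) with ([(d, j)] ++ y). now rewrite vdot_app_r, E, Cplus_conj, Cconj_conj, IH.
Qed.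

Lemma vcoef_map {I J : Type} (f : I -> J) (y : vec I) i :
  (forall j, In j (map snd y) -> f i = f j -> i = j) -> vcoef (vmap f y) (f i) = vcoef y i.
Proof.
  induction y as [|[c j] y IH]; intros Hf; trivial.
  rewrite vmap_cons; cbn [vcoef]; rewrite IH; [|intros; apply Hf; simpl; auto].
  f_equal. f_equal. unfold delta.
  do 2 destruct excluded_middle_informative; trivial; try congruence.
  exfalso; apply n, Hf; simpl; auto.
Qed.

(** Injectivity is asked only between occurring indices, because the renaming of indices into [nat]
    in [B2_le_of_vec] is known to be injective only there. *)
Lemma vdot_map_in {I J : Type} (f : I -> J) (x y : vec I) :
  (forall i j, In i (map snd x) -> In j (map snd y) -> f i = f j -> i = j) ->
  vdot (vmap f x) (vmap f y) = vdot x y.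
Proof.
  induction x as [|[c j] x IH]; intros Hf; trivial.
  rewrite vmap_cons; cbn [vdot]. rewrite vcoef_map; [|intros; apply Hf; simpl; auto].
  rewrite IH; [trivial|intros; apply Hf; simpl; auto].
Qed.

Lemma vdot_map {I J : Type} (f : I -> J) (x y : vec I) :
  (forall i j, f i = f j -> i = j) -> vdot (vmap f x) (vmap f y) = vdot x y.
Proof. intros; apply vdot_map_in; auto. Qed.

Lemma vdot_map_disjoint {I I' J : Type} (f : I -> J) (g : I' -> J) (x : vec I) (y : vec I') :
  (forall i j, f i <> g j) -> vdot (vmap f x) (vmap g y) = RtoC 0.
Proof.
  intros H. assert (Hc : forall i, vcoef (vmap g y) (f i) = RtoC 0).
  { intros i; induction y as [|[c j] y IH]; trivial.
    rewrite vmap_cons; cbn [vcoef]; rewrite IH, delta_neq by auto. ring. }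
  induction x as [|[c j] x IH]; trivial.
  rewrite vmap_cons; cbn [vdot]; rewrite IH, Hc. ring.
Qed.

Lemma vcoef_tens {I J : Type} (x : vec I) (y : vec J) i j :
  vcoef (vtens x y) (i, j) = vcoef x i * vcoef y j.
Proof.
  induction x as [|[c i'] x IH]; simpl; [ring|].
  rewrite vcoef_app, IH. rewrite Cmult_plus_distr_r. f_equal.
  clear IH. induction y as [|[d j'] y IH]; [simpl; ring|].
  rewrite vscal_cons, vmap_cons; cbn [vcoef]; rewrite IH, delta_pair, Cmult_conj. ring.
Qed.

Lemma vdot_tens {I J : Type} (x x' : vec I) (y y' : vec J) :
  vdot (vtens x y) (vtens x' y') = vdot x x' * vdot y y'.
Proof.
  induction x as [|[c i] x IH]; simpl; [ring|].
  rewrite vdot_app_l, IH, Cmult_plus_distr_r. f_equal. clear IH.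
  induction y as [|[d j] y IH]; [simpl; ring|].
  rewrite vscal_cons, vmap_cons; cbn [vdot]; rewrite IH, vcoef_tens. ring.
Qed.

(** Records that the squared norm is a real number, so that estimates take place in [R].
    Nonnegativity is carried along, which spares a positivity proof for formal sums. *)
Definition vnorm2 {I : Type} (x : vec I) (t : R) : Prop := vdot x x = RtoC t /\ (0 <= t)%R.

Lemma vnorm2_scal {I : Type} (x : vec I) k t :
  vnorm2 x t -> vnorm2 (vscal k x) (Cmod k * Cmod k * t).
Proof.
  intros [Hx Ht]; split.
  - rewrite vdot_scal_l, vdot_scal_r, Hx, Cmult_assoc, mul_conj_RtoC, <- RtoC_mult.
    reflexivity.
  - apply Rmult_le_pos; trivial. apply Rle_0_sqr.
Qed.

Lemma vnorm2_tens {I J : Type} (x : vec I) (y : vec J) s t :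
  vnorm2 x s -> vnorm2 y t -> vnorm2 (vtens x y) (s * t).
Proof.
  intros [Hx Hs] [Hy Ht]; split; [|now apply Rmult_le_pos].
  now rewrite vdot_tens, Hx, Hy, RtoC_mult.
Qed.

Definition vsum {I J : Type} (x : vec I) (y : vec J) : vec (I + J) := vmap inl x ++ vmap inr y.

Lemma vdot_vsum {I J : Type} (x x' : vec I) (y y' : vec J) :
  vdot (vsum x y) (vsum x' y') = vdot x x' + vdot y y'.
Proof.
  unfold vsum. rewrite vdot_app_l, !vdot_app_r.
  rewrite (vdot_map inl), (vdot_map inr), !vdot_map_disjoint by congruence. ring.
Qed.

Lemma vnorm2_vsum {I J : Type} (x : vec I) (y : vec J) s t :
  vnorm2 x s -> vnorm2 y t -> vnorm2 (vsum x y) (s + t).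
Proof.
  intros [Hx Hs] [Hy Ht]; split; [|lra]. now rewrite vdot_vsum, Hx, Hy, RtoC_plus.
Qed.

Lemma vnorm2_single {I : Type} k (i : I) : vnorm2 [(k, i)] (Cmod k * Cmod k).
Proof.
  split; [|apply Rle_0_sqr]. simpl. rewrite delta_eq, <- mul_conj_RtoC. ring.
Qed.

(** * Hilbert space lemmas *)

Section HilbertLemmas.
Variable H : hilbert.
Local Notation "x + y" := (hadd H x y).
Local Notation "k *: x" := (hscal H k x) (at level 40).
Local Notation "'<<' x , y '>>'" := (hinner H x y).

Lemma hinnerDr (x y z : H) : << x, y + z >> = Cplus << x, y >> << x, z >>.
Proof. now rewrite hinner_sym, hinnerDl, Cplus_conj, <- !hinner_sym. Qed.

Lemma hinnerZr k (x y : H) : << x, k *: y >> = Cmult (Cconj k) << x, y >>.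
Proof. now rewrite hinner_sym, hinnerZl, Cmult_conj, <- hinner_sym. Qed.

Lemma hinner_norm (x : H) : << x, x >> = RtoC (Re << x, x >>).
Proof.
  destruct (hinner_pos H x) as [Hi _]. destruct << x, x >> as [a b].
  simpl in *. now subst.
Qed.

Lemma hinner_zero_l (y : H) : << hzero H, y >> = RtoC 0.
Proof.
  assert (E : << hzero H, y >> = Cplus << hzero H, y >> << hzero H, y >>).
  { rewrite <- hinnerDl. now rewrite hadd0. }
  replace (RtoC 0) with (<< hzero H, y >> - << hzero H, y >>)%C by ring.
  rewrite E at 2. ring.
Qed.

Lemma hinner_zero_r (y : H) : << y, hzero H >> = RtoC 0.
Proof. rewrite hinner_sym, hinner_zero_l. apply conj_RtoC. Qed.

Lemma hadd_cancel (x y z : H) : x + z = y + z -> x = y.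
Proof.
  intros E. rewrite <- (hadd0 H x), <- (hadd0 H y), (haddC H _ x), (haddC H _ y).
  rewrite <- (haddN H z), !haddA, E. reflexivity.
Qed.

Lemma hscal0 (x : H) : RtoC 0 *: x = hzero H.
Proof.
  apply (hadd_cancel _ _ (RtoC 0 *: x)). rewrite <- hscalDl, hadd0. f_equal. ring.
Qed.

Lemma cauchy_schwarz (x y : H) :
  (Cmod << x, y >> * Cmod << x, y >> <= Re << x, x >> * Re << y, y >>)%R.
Proof.
  set (u := << x, y >>). set (a := Re << x, x >>). set (b := Re << y, y >>).
  (* Positivity of the squared norm of [x - k <x, y> y], as a quadratic polynomial in [k]. *)
  assert (Q : forall k : R, (0 <= a - 2 * k * (Cmod u * Cmod u)
                               + k * k * (Cmod u * Cmod u) * b)%R).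
  { intros k. set (z := x + (Copp (RtoC k * u)) *: y).
    destruct (hinner_pos H z) as [_ Hz].
    assert (E : << z, z >> = RtoC (a - 2 * k * (Cmod u * Cmod u)
                               + k * k * (Cmod u * Cmod u) * b)).
    { unfold z. rewrite !hinnerDl, !hinnerDr, !hinnerZl, !hinnerZr.
      rewrite Copp_conj, Cmult_conj, conj_RtoC.
      rewrite (hinner_norm x), (hinner_norm y), (hinner_sym H x y).
      fold u a b. rewrite !RtoC_plus, RtoC_minus, !RtoC_mult.
      rewrite <- (RtoC_mult (Cmod u)), <- mul_conj_RtoC. ring. }
    rewrite E in Hz. exact Hz. }
  assert (Ha : (0 <= a)%R) by apply hinner_pos.
  assert (Hb : (0 <= b)%R) by apply hinner_pos.
  assert (Hu := Cmod_ge_0 u).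
  destruct (Rle_lt_or_eq_dec 0 b Hb) as [Hb'|Hb'].
  (* The minimum of the quadratic is at [k = 1 / b]. *)
  - specialize (Q (/ b)%R).
    replace (a - 2 * / b * (Cmod u * Cmod u) + / b * / b * (Cmod u * Cmod u) * b)%R
      with ((a * b - Cmod u * Cmod u) * / b)%R in Q by (field; lra).
    apply Rmult_le_reg_r with (/ b)%R; [now apply Rinv_0_lt_compat|]. lra.
  - rewrite <- Hb' in *. rewrite Rmult_0_r.
    destruct (Rle_lt_dec (Cmod u * Cmod u) 0) as [|Hp]; trivial. exfalso.
    (* For [b = 0] the polynomial is affine in [k], and this [k] gives it the negative value
       [- a - 2]. *)
    specialize (Q ((a + 1) / (Cmod u * Cmod u))%R).
    replace (a - 2 * ((a + 1) / (Cmod u * Cmod u)) * (Cmod u * Cmod u) +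
      (a + 1) / (Cmod u * Cmod u) * ((a + 1) / (Cmod u * Cmod u)) * (Cmod u * Cmod u) * 0)%R
      with (- a - 2)%R in Q by (field; nra). lra.
Qed.

(** * Gram-Schmidt *)

Variable u : nat -> H.

Definition gs_proj (es : list H) (x : H) : H :=
  fold_right (fun e z => << x, e >> *: e + z) (hzero H) es.

Definition hsub (x y : H) : H := x + Copp (RtoC 1) *: y.

(* A vector of norm [0] normalises to [hzero], since [/ 0 = 0] makes the scalar harmless. *)
Definition normalize (x : H) : H := RtoC (/ sqrt (Re << x, x >>)) *: x.

Fixpoint gs_list (n : nat) : list H :=
  match n with
  | O => []
  | S m => normalize (hsub (u m) (gs_proj (gs_list m) (u m))) :: gs_list m
  end.

Definition gs_vec (n : nat) : H := hd (hzero H) (gs_list (S n)).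

Definition orthosys (es : list H) : Prop :=
  ForallOrdPairs (fun e f => << e, f >> = RtoC 0) es /\
  List.Forall (fun e => << e, e >> = RtoC 1 \/ e = hzero H) es.

Lemma hinner_proj_l (es : list H) (x y : H) :
  << gs_proj es x, y >> = fold_right (fun e z => Cplus (<< x, e >> * << e, y >>) z) (RtoC 0) es.
Proof.
  induction es as [|e es IH]; simpl; [apply hinner_zero_l|].
  now rewrite hinnerDl, hinnerZl, IH.
Qed.

(** By orthogonality only the term of [f] itself survives; if [f] is zero, both sides vanish. *)
Lemma gs_proj_spec (es : list H) (x : H) f :
  orthosys es -> In f es -> << gs_proj es x, f >> = << x, f >>.
Proof.
  rewrite hinner_proj_l. induction es as [|e es IH]; simpl; [tauto|].
  intros [Ho Hn] Hf. inversion_clear Ho as [|? ? Ho1 Ho2]. inversion_clear Hn as [|? ? Hn1 Hn2].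
  rewrite Forall_forall in Ho1. destruct Hf as [<-|Hf].
  - match goal with |- context [fold_right ?f ?z es] => replace (fold_right f z es) with (RtoC 0) end.
    + destruct Hn1 as [->| ->]; [ring|]. rewrite !hinner_zero_r; ring.
    + clear - Ho1. induction es as [|f es IH]; simpl; trivial.
      rewrite <- IH by (intros; apply Ho1; simpl; auto).
      rewrite (hinner_sym H e f), Ho1 by (simpl; auto). rewrite conj_RtoC. ring.
  - rewrite (Ho1 f Hf), IH; trivial; [ring|]. now split.
Qed.

Lemma normalize_cases (x : H) :
  (<< normalize x, normalize x >> = RtoC 1 \/ normalize x = hzero H) /\
  << x, normalize x >> *: normalize x = x.
Proof.
  unfold normalize. rewrite !hinnerZl, !hinnerZr, conj_RtoC, <- hscalA.
  destruct (hinner_pos H x) as [Hi [Hp|Hp]].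
  - assert (E : sqrt (Re << x, x >>) <> 0%R) by now apply Rgt_not_eq, sqrt_lt_R0.
    assert (E2 : << x, x >> = RtoC (sqrt (Re << x, x >>) * sqrt (Re << x, x >>))).
    { rewrite sqrt_sqrt by lra. apply hinner_norm. }
    set (s := sqrt (Re << x, x >>)) in *. clearbody s. rewrite E2, <- !RtoC_mult.
    split; [left; f_equal; now field|].
    replace (/ _ * _ * / _)%R with 1%R by (now field). apply hscal1.
  - assert (E : x = hzero H).
    { apply hinner_def. rewrite hinner_norm, <- Hp. reflexivity. }
    rewrite <- Hp, sqrt_0, Rinv_0. split; [right; apply hscal0|].
    rewrite Cmult_0_r, hscal0. now symmetry.
Qed.

Lemma hsub_add (x y : H) : hsub x y + y = x.
Proof.
  unfold hsub. rewrite <- haddA. rewrite <- (hscal1 H y) at 2.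
  rewrite <- hscalDl. replace (Copp (RtoC 1) + RtoC 1)%C with (RtoC 0) by ring.
  rewrite hscal0, haddC. apply hadd0.
Qed.

Lemma gs_list_orthosys n : orthosys (gs_list n).
Proof.
  induction n as [|n [IH1 IH2]]; simpl; [split; constructor|].
  split; constructor; trivial; [|apply normalize_cases].
  apply Forall_forall. intros f Hf. unfold normalize.
  rewrite hinnerZl. generalize (RtoC (/ sqrt (Re
    << hsub (u n) (gs_proj (gs_list n) (u n)), hsub (u n) (gs_proj (gs_list n) (u n)) >>))).
  intros k. unfold hsub.
  rewrite hinnerDl, hinnerZl, gs_proj_spec; trivial; [ring|now split].
Qed.

(** The residual of the last vector is orthogonal to the earlier list, so its component along its
    own normalisation gives it back. An earlier [u k] lies in the span of the earlier list and is
    therefore orthogonal to the new vector. *)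
Lemma gs_list_span n k : (k < n)%nat -> gs_proj (gs_list n) (u k) = u k.
Proof.
  revert k; induction n as [|n IH]; [lia|]. intros k Hk.
  destruct (gs_list_orthosys (S n)) as [Ho Hn].
  destruct (Nat.eq_dec k n) as [->|Hkn].
  - simpl. set (w := hsub (u n) (gs_proj (gs_list n) (u n))).
    assert (Hw : w + gs_proj (gs_list n) (u n) = u n) by apply hsub_add.
    assert (E : << u n, normalize w >> = << w, normalize w >>).
    { rewrite <- Hw at 1. rewrite hinnerDl, hinner_proj_l.
      match goal with |- context [fold_right ?f ?z ?es] =>
        replace (fold_right f z es) with (RtoC 0) end; [ring|].
      simpl in Ho. inversion_clear Ho as [|? ? Ho1 Ho2]. rewrite Forall_forall in Ho1.
      fold w in Ho1. clearbody w. clear - Ho1. induction (gs_list n) as [|f es IH]; simpl; trivial.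
      rewrite <- IH by (intros; apply Ho1; simpl; auto).
      rewrite (hinner_sym H (normalize w) f), Ho1 by (simpl; auto). rewrite conj_RtoC. ring. }
    rewrite E. now rewrite (proj2 (normalize_cases w)).
  - assert (Hk' : (k < n)%nat) by lia. specialize (IH k Hk').
    simpl. set (e := normalize _).
    replace << u k, e >> with (RtoC 0); [now rewrite hscal0, hadd0|].
    rewrite <- IH, hinner_proj_l.
    simpl in Ho. inversion_clear Ho as [|? ? Ho1 Ho2]. rewrite Forall_forall in Ho1.
    fold e in Ho1. clearbody e. clear - Ho1. induction (gs_list n) as [|f es IH]; simpl; trivial.
    rewrite <- IH by (intros; apply Ho1; simpl; auto).
    rewrite (hinner_sym H e f), Ho1 by (simpl; auto). rewrite conj_RtoC. ring.
Qed.

Fixpoint gs_coords (n : nat) (x : H) : vec nat :=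
  match n with
  | O => []
  | S m => (<< x, gs_vec m >>, m) :: gs_coords m x
  end.

Lemma vcoef_gs_coords n (x : H) i :
  vcoef (gs_coords n x) i = if Compare_dec.lt_dec i n then << gs_vec i, x >> else RtoC 0.
Proof.
  induction n as [|n IH]; simpl; trivial. rewrite IH.
  rewrite <- hinner_sym. unfold delta.
  destruct (excluded_middle_informative (i = n)) as [->|Hn].
  - destruct (Compare_dec.lt_dec n n); [lia|]. destruct (Compare_dec.lt_dec n (S n)); [ring|lia].
  - destruct (Compare_dec.lt_dec i n), (Compare_dec.lt_dec i (S n)); try lia; ring.
Qed.

Lemma gs_proj_extend n x y : << gs_proj (gs_list n) x, y >> =
  vdot (gs_coords n x) (gs_coords n y).
Proof.
  assert (Hg : forall m, (n <= m)%nat -> << gs_proj (gs_list n) x, y >> =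
    vdot (gs_coords n x) (gs_coords m y)); [|apply Hg; lia].
  rewrite hinner_proj_l.
  induction n as [|n IH]; intros m Hm; trivial.
  cbn [gs_coords vdot]. rewrite <- IH by lia. rewrite vcoef_gs_coords.
  destruct (Compare_dec.lt_dec n m); [|lia]. reflexivity.
Qed.

(** Since [u k] lies in the span of the first [m] vectors, coordinates of [y] beyond [m] do not
    contribute. Hence two vectors may be expanded to different lengths. *)
Lemma gs_coords_trunc m n k y : (k < m)%nat -> (m <= n)%nat ->
  vdot (gs_coords m (u k)) (gs_coords n y) = << u k, y >>.
Proof.
  intros Hk Hm. rewrite <- (gs_list_span m k Hk) at 2.
  rewrite gs_proj_extend. clear Hk. set (x := u k). clearbody x.
  assert (Hg : forall l, (l <= m)%nat ->
    vdot (gs_coords l x) (gs_coords n y) = vdot (gs_coords l x) (gs_coords m y));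
    [|apply Hg; lia].
  induction l as [|l IH]; intros Hl; simpl; trivial.
  rewrite IH by lia. rewrite !vcoef_gs_coords.
  destruct (Compare_dec.lt_dec l n), (Compare_dec.lt_dec l m); try lia. reflexivity.
Qed.

(** The vector [u k] has only the coordinates [0] to [k], so a sequence in an arbitrary Hilbert
    space can be replaced by finite formal sums with the same Gram matrix. *)
Lemma gram_schmidt : exists c : nat -> vec nat, forall k l, vdot (c k) (c l) = << u k, u l >>.
Proof.
  exists (fun k => gs_coords (S k) (u k)). intros k l.
  destruct (Compare_dec.le_lt_dec k l).
  - apply gs_coords_trunc; lia.
  - rewrite vdot_sym, gs_coords_trunc by lia. now rewrite <- hinner_sym.
Qed.

End HilbertLemmas.

(** * The Hilbert space of square-summable sequences *)

Lemma sum_n_le_Series (a : nat -> R) N :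
  (forall n, 0 <= a n)%R -> ex_series a -> (sum_n a N <= Series a)%R.
Proof.
  intros Ha [l Hl]. rewrite (is_series_unique a l Hl).
  change (is_lim_seq (sum_n a) l) in Hl.
  apply (is_lim_seq_incr_compare (sum_n a)); trivial.
  intros n. rewrite sum_Sn. specialize (Ha (S n)). unfold plus; simpl. lra.
Qed.

Lemma term_le_Series (a : nat -> R) k :
  (forall n, 0 <= a n)%R -> ex_series a -> (a k <= Series a)%R.
Proof.
  intros Ha He. apply Rle_trans with (sum_n a k); [|now apply sum_n_le_Series].
  destruct k as [|k]; [rewrite sum_O; lra|]. rewrite sum_Sn. unfold plus; simpl.
  enough (0 <= sum_n a k)%R by lra.
  induction k as [|k IH]; [rewrite sum_O; auto|]. rewrite sum_Sn. unfold plus; simpl.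
  specialize (Ha (S k)). lra.
Qed.

Lemma bounded_sums_series (a : nat -> R) M :
  (forall n, 0 <= a n)%R -> (forall N, sum_n a N <= M)%R -> ex_series a /\ (Series a <= M)%R.
Proof.
  intros Ha HM. destruct (ex_finite_lim_seq_incr (sum_n a) M) as [l Hl]; trivial.
  { intros n. rewrite sum_Sn. specialize (Ha (S n)). unfold plus; simpl. lra. }
  split; [now exists l|]. rewrite (is_series_unique a l Hl).
  assert (E : Rbar_le l M); [|exact E].
  apply (is_lim_seq_le (sum_n a) (fun _ => M)); trivial. apply is_lim_seq_const.
Qed.

Lemma Series_zero (a : nat -> R) : (forall n, a n = 0)%R -> Series a = 0%R.
Proof.
  intros H. rewrite (Series_ext a (fun n => 0 * a n)%R) by (intros; rewrite H; ring).
  rewrite Series_scal_l. ring.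
Qed.

Definition nsq (c : C) : R := (Re c * Re c + Im c * Im c)%R.

Lemma nsq_ge0 c : (0 <= nsq c)%R.
Proof. unfold nsq; nra. Qed.

Lemma Re_mul_conj c : Re (c * Cconj c) = nsq c.
Proof. unfold nsq; destruct c; simpl; ring. Qed.

Lemma Im_mul_conj c : Im (c * Cconj c) = 0%R.
Proof. destruct c; simpl; ring. Qed.

Definition sqsum (x : nat -> C) : Prop := ex_series (fun n => nsq (x n)).

(** [B2_le] asks for a complete inner product space, whereas the factorizations to be built consist
    of finite sums. This space serves only as their target. *)
Definition l2 := {x : nat -> C | sqsum x}.

Lemma l2_ext (x y : l2) : (forall n, proj1_sig x n = proj1_sig y n) -> x = y.
Proof.
  destruct x as [x Hx], y as [y Hy]; simpl; intros E.
  apply functional_extensionality in E. subst. f_equal. apply proof_irrelevance.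
Qed.

Lemma sqsum_dominated (p : nat -> R) (x y : nat -> C) k :
  sqsum x -> sqsum y -> (forall n, Rabs (p n) <= k * (nsq (x n) + nsq (y n)))%R -> ex_series p.
Proof.
  intros Hx Hy Hp.
  apply (@ex_series_le R_AbsRing R_CompleteNormedModule p
    (fun n => k * (nsq (x n) + nsq (y n)))%R); trivial.
  apply (ex_series_scal_l k (fun n => nsq (x n) + nsq (y n))%R).
  now apply (ex_series_plus (fun n => nsq (x n)) (fun n => nsq (y n))).
Qed.

Lemma sqsum_zero : sqsum (fun _ => RtoC 0).
Proof.
  apply (ex_series_ext (fun n => 0 * 0 ^ n)%R).
  - intros n. unfold nsq; simpl. ring.
  - apply (ex_series_scal_l 0%R (fun n => 0 ^ n)%R). apply ex_series_geom. rewrite Rabs_R0; lra.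
Qed.

Lemma sqsum_add x y : sqsum x -> sqsum y -> sqsum (fun n => x n + y n).
Proof.
  intros Hx Hy. apply (sqsum_dominated _ x y 2 Hx Hy). intros n.
  rewrite Rabs_pos_eq by apply nsq_ge0. unfold nsq.
  destruct (x n) as [a b], (y n) as [c d]; simpl.
  assert (0 <= (a - c) * (a - c))%R by apply Rle_0_sqr.
  assert (0 <= (b - d) * (b - d))%R by apply Rle_0_sqr. lra.
Qed.

Lemma sqsum_scal k x : sqsum x -> sqsum (fun n => k * x n).
Proof.
  intros Hx. apply (ex_series_ext (fun n => nsq k * nsq (x n))%R).
  - intros n. unfold nsq. destruct k, (x n); simpl; ring.
  - now apply (ex_series_scal_l (nsq k) (fun n => nsq (x n))).
Qed.

Lemma sqsum_opp x : sqsum x -> sqsum (fun n => - x n).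
Proof.
  apply ex_series_ext. intros n. unfold nsq. destruct (x n); simpl; ring.
Qed.

Lemma sqsum_prod_Re x y : sqsum x -> sqsum y -> ex_series (fun n => Re (x n * Cconj (y n))).
Proof.
  intros Hx Hy. apply (sqsum_dominated _ x y 1 Hx Hy). intros n. unfold nsq.
  destruct (x n) as [a b], (y n) as [c d]; simpl. apply Rabs_le.
  split; [pose proof (Rle_0_sqr (a + c)); pose proof (Rle_0_sqr (b + d))
         |pose proof (Rle_0_sqr (a - c)); pose proof (Rle_0_sqr (b - d))]; unfold Rsqr in *; nra.
Qed.

Lemma sqsum_prod_Im x y : sqsum x -> sqsum y -> ex_series (fun n => Im (x n * Cconj (y n))).
Proof.
  intros Hx Hy. apply (sqsum_dominated _ x y 1 Hx Hy). intros n. unfold nsq.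
  destruct (x n) as [a b], (y n) as [c d]; simpl. apply Rabs_le.
  split; [pose proof (Rle_0_sqr (a - d)); pose proof (Rle_0_sqr (b + c))
         |pose proof (Rle_0_sqr (a + d)); pose proof (Rle_0_sqr (b - c))]; unfold Rsqr in *; nra.
Qed.

Definition l2_zero : l2 := exist _ _ sqsum_zero.
Definition l2_add (x y : l2) : l2 := exist _ _ (sqsum_add _ _ (proj2_sig x) (proj2_sig y)).
Definition l2_opp (x : l2) : l2 := exist _ _ (sqsum_opp _ (proj2_sig x)).
Definition l2_scal (k : C) (x : l2) : l2 := exist _ _ (sqsum_scal k _ (proj2_sig x)).
Definition l2_inner (x y : l2) : C :=
  (Series (fun n => Re (proj1_sig x n * Cconj (proj1_sig y n))),
   Series (fun n => Im (proj1_sig x n * Cconj (proj1_sig y n)))).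

Lemma l2_inner_norm (x : l2) : Re (l2_inner x x) = Series (fun n => nsq (proj1_sig x n)).
Proof. simpl. apply Series_ext. intros n; apply Re_mul_conj. Qed.

Lemma l2_inner_add (x y z : l2) : l2_inner (l2_add x y) z = l2_inner x z + l2_inner y z.
Proof.
  destruct x as [x Hx], y as [y Hy], z as [z Hz]. apply injective_projections.
  - change (Series (fun n => Re ((x n + y n) * Cconj (z n))%C) =
      Series (fun n => Re (x n * Cconj (z n))%C) + Series (fun n => Re (y n * Cconj (z n))%C))%R.
    rewrite <- Series_plus by auto using sqsum_prod_Re.
    apply Series_ext; intros n; destruct (x n), (y n), (z n); simpl; ring.
  - change (Series (fun n => Im ((x n + y n) * Cconj (z n))%C) =
      Series (fun n => Im (x n * Cconj (z n))%C) + Series (fun n => Im (y n * Cconj (z n))%C))%R.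
    rewrite <- Series_plus by auto using sqsum_prod_Im.
    apply Series_ext; intros n; destruct (x n), (y n), (z n); simpl; ring.
Qed.

Lemma l2_inner_scal a (x y : l2) : l2_inner (l2_scal a x) y = a * l2_inner x y.
Proof.
  destruct x as [x Hx], y as [y Hy].
  pose proof (sqsum_prod_Re x y Hx Hy) as HR. pose proof (sqsum_prod_Im x y Hx Hy) as HI.
  apply injective_projections.
  - change (Series (fun n => Re (a * x n * Cconj (y n))%C) =
      fst a * Series (fun n => Re (x n * Cconj (y n))%C) -
      snd a * Series (fun n => Im (x n * Cconj (y n))%C))%R.
    rewrite <- !Series_scal_l, <- Series_minus;
      [|now apply (ex_series_scal_l (fst a)) in HR|now apply (ex_series_scal_l (snd a)) in HI].
    apply Series_ext. intros n. destruct a, (x n), (y n); simpl; ring.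
  - change (Series (fun n => Im (a * x n * Cconj (y n))%C) =
      fst a * Series (fun n => Im (x n * Cconj (y n))%C) +
      snd a * Series (fun n => Re (x n * Cconj (y n))%C))%R.
    rewrite <- !Series_scal_l, <- Series_plus;
      [|now apply (ex_series_scal_l (fst a)) in HI|now apply (ex_series_scal_l (snd a)) in HR].
    apply Series_ext. intros n. destruct a, (x n), (y n); simpl; ring.
Qed.

Lemma l2_inner_sym (x y : l2) : l2_inner y x = Cconj (l2_inner x y).
Proof.
  apply injective_projections.
  - apply Series_ext. intros n. destruct (proj1_sig x n), (proj1_sig y n); simpl; ring.
  - change (Series (fun n => Im (proj1_sig y n * Cconj (proj1_sig x n))%C) =
      - Series (fun n => Im (proj1_sig x n * Cconj (proj1_sig y n))%C))%R.
    rewrite <- Series_opp. apply Series_ext. intros n.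
    destruct (proj1_sig x n), (proj1_sig y n); simpl; ring.
Qed.

Lemma l2_inner_pos (x : l2) : Im (l2_inner x x) = 0%R /\ (0 <= Re (l2_inner x x))%R.
Proof.
  split.
  - apply Series_zero. intros n. apply Im_mul_conj.
  - rewrite l2_inner_norm. eapply Rle_trans; [|apply (term_le_Series _ 0)]; intros;
      [apply nsq_ge0 ..|apply (proj2_sig x)].
Qed.

Lemma l2_inner_def (x : l2) : l2_inner x x = RtoC 0 -> x = l2_zero.
Proof.
  intros E. apply l2_ext. intros n. simpl.
  assert (H := l2_inner_norm x). rewrite E in H. simpl in H.
  assert (H2 := term_le_Series (fun n => nsq (proj1_sig x n)) n
    (fun n => nsq_ge0 _) (proj2_sig x)). rewrite <- H in H2. clear E H.
  unfold nsq in H2. destruct (proj1_sig x n) as [a b]; simpl in *.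
  unfold RtoC. f_equal; nra.
Qed.

Lemma is_lim_seq_sum_n (f : nat -> nat -> R) (l : nat -> R) K :
  (forall k, is_lim_seq (fun n => f n k) (l k)) ->
  is_lim_seq (fun n => sum_n (f n) K) (sum_n l K).
Proof.
  intros H. induction K as [|K IH].
  - apply (is_lim_seq_ext (fun n => f n 0%nat)); [intros; now rewrite sum_O|]. now rewrite sum_O.
  - apply (is_lim_seq_ext (fun n => sum_n (f n) K + f n (S K))%R); [intros; now rewrite sum_Sn|].
    rewrite sum_Sn. now apply is_lim_seq_plus'.
Qed.

Definition l2_dist2 (x y : l2) : R := Re (l2_inner (l2_add x (l2_opp y)) (l2_add x (l2_opp y))).

Lemma l2_dist2_eq (x y : l2) :
  l2_dist2 x y = Series (fun n => nsq (proj1_sig x n - proj1_sig y n)).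
Proof. unfold l2_dist2. rewrite l2_inner_norm. reflexivity. Qed.

Lemma sqsum_sub x y : sqsum x -> sqsum y -> sqsum (fun n => x n - y n).
Proof. intros; apply sqsum_add; trivial. now apply sqsum_opp. Qed.

Lemma l2_complete (u : nat -> l2) :
  (forall eps : R, (0 < eps)%R -> exists N, forall m n, (N <= m)%nat -> (N <= n)%nat ->
     (sqrt (l2_dist2 (u m) (u n)) < eps)%R) ->
  exists l, forall eps : R, (0 < eps)%R -> exists N, forall n, (N <= n)%nat ->
     (sqrt (l2_dist2 (u n) l) < eps)%R.
Proof.
  intros HC. set (c := fun n k => proj1_sig (u n) k).
  assert (Hterm : forall m n k, (nsq (c m k - c n k) <= l2_dist2 (u m) (u n))%R).
  { intros. rewrite l2_dist2_eq. apply (term_le_Series (fun n0 => nsq (c m n0 - c n n0)) k).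
    - intros; apply nsq_ge0.
    - apply sqsum_sub; apply proj2_sig. }
  assert (Hd : forall m n, (0 <= l2_dist2 (u m) (u n))%R) by (intros; apply l2_inner_pos).
  (* Coordinatewise convergence, stated for a projection [pr] so as to serve both real and imaginary
     parts. *)
  assert (HCau : forall (pr : C -> R),
    (forall a b, (Rabs (pr a - pr b) * Rabs (pr a - pr b) <= nsq (a - b))%R) ->
    forall k, ex_finite_lim_seq (fun n => pr (c n k))).
  { intros pr Hpr k. apply ex_lim_seq_cauchy_corr. intros eps.
    destruct (HC eps (cond_pos eps)) as [N HN]. exists N. intros n m Hn Hm.
    specialize (HN n m Hn Hm). specialize (Hterm n m k). specialize (Hpr (c n k) (c m k)).
    pose proof (Rabs_pos (pr (c n k) - pr (c m k))).
    apply Rle_lt_trans with (sqrt (l2_dist2 (u n) (u m))); trivial.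
    rewrite <- (sqrt_square (Rabs _)) by trivial. apply sqrt_le_1_alt. lra. }
  assert (HRe := HCau Re). assert (HIm := HCau Im). clear HCau.
  assert (HRe' : forall k, ex_finite_lim_seq (fun n => Re (c n k))).
  { apply HRe. intros a b. rewrite <- Rabs_mult, Rabs_pos_eq by apply Rle_0_sqr.
    unfold nsq. destruct a as [a a'], b as [b b']; simpl.
    pose proof (Rle_0_sqr (a - b)). pose proof (Rle_0_sqr (a' - b')). unfold Rsqr in *. lra. }
  assert (HIm' : forall k, ex_finite_lim_seq (fun n => Im (c n k))).
  { apply HIm. intros a b. rewrite <- Rabs_mult, Rabs_pos_eq by apply Rle_0_sqr.
    unfold nsq. destruct a as [a a'], b as [b b']; simpl.
    pose proof (Rle_0_sqr (a - b)). pose proof (Rle_0_sqr (a' - b')). unfold Rsqr in *. lra. }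
  clear HRe HIm.
  set (l := fun k => (real (Lim_seq (fun n => Re (c n k))), real (Lim_seq (fun n => Im (c n k)))) : C).
  assert (Hl : forall m k, is_lim_seq (fun n => nsq (c m k - c n k)) (nsq (c m k - l k))).
  { intros m k.
    pose proof (Lim_seq_correct' _ (HRe' k)) as LR. pose proof (Lim_seq_correct' _ (HIm' k)) as LI.
    assert (LR2 : is_lim_seq (fun n => Re (c m k) - Re (c n k))%R (Re (c m k) - Re (l k))%R)
      by (apply is_lim_seq_minus'; [apply is_lim_seq_const|exact LR]).
    assert (LI2 : is_lim_seq (fun n => Im (c m k) - Im (c n k))%R (Im (c m k) - Im (l k))%R)
      by (apply is_lim_seq_minus'; [apply is_lim_seq_const|exact LI]).
    exact (is_lim_seq_plus' _ _ _ _ (is_lim_seq_mult' _ _ _ _ LR2 LR2)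
      (is_lim_seq_mult' _ _ _ _ LI2 LI2)). }
  (* The Cauchy estimate holds for each partial sum, a finite sum, and there the limit in the second
     index can be taken termwise. Bounded partial sums then control the whole series. *)
  assert (Hmain : forall eps : R, (0 < eps)%R -> exists N, forall m, (N <= m)%nat ->
    sqsum (fun k => c m k - l k) /\ (Series (fun k => nsq (c m k - l k)) <= eps * eps)%R).
  { intros eps He. destruct (HC eps He) as [N HN]. exists N. intros m Hm.
    apply bounded_sums_series; [intros; apply nsq_ge0|]. intros K.
    pose proof (is_lim_seq_sum_n (fun n k => nsq (c m k - c n k)) _ K (Hl m)) as HS.
    assert (E : Rbar_le (sum_n (fun k => nsq (c m k - l k)) K) (eps * eps)%R); [|exact E].
    apply (is_lim_seq_le_loc (fun n => sum_n (fun k => nsq (c m k - c n k)) K)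
             (fun _ => (eps * eps)%R)); trivial; [|apply is_lim_seq_const].
    exists N. intros n Hn. apply Rle_trans with (l2_dist2 (u m) (u n)).
    - rewrite l2_dist2_eq. apply sum_n_le_Series; [intros; apply nsq_ge0|].
      apply sqsum_sub; apply proj2_sig.
    - rewrite <- (sqrt_sqrt (l2_dist2 _ _)) by apply Hd.
      specialize (HN m n Hm Hn). pose proof (sqrt_pos (l2_dist2 (u m) (u n))). nra. }
  (* The limit is square summable as the difference of [c N] and the square summable sequence
     [c N - l]. *)
  assert (HL : sqsum l).
  { destruct (Hmain 1%R Rlt_0_1) as [N HN]. destruct (HN N (le_n N)) as [HN' _].
    apply (ex_series_ext (fun k => nsq (c N k - (c N k - l k)))).
    - intros n. unfold nsq. destruct (c N n), (l n); simpl; ring.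
    - apply sqsum_sub; trivial. apply proj2_sig. }
  exists (exist _ l HL). intros eps He.
  (* Passing to the limit has made the bound non-strict; halving restores strictness. *)
  destruct (Hmain (eps / 2)%R) as [N HN]; [lra|]. exists N. intros n Hn.
  destruct (HN n Hn) as [_ HN']. rewrite l2_dist2_eq. simpl proj1_sig. fold (c n).
  apply Rle_lt_trans with (eps / 2)%R; [|lra].
  rewrite <- (sqrt_square (eps / 2)) by lra. now apply sqrt_le_1_alt.
Qed.

Definition l2_hilbert : hilbert.
Proof.
  refine (Hilbert l2 l2_zero l2_add l2_opp l2_scal l2_inner _ _ _ _ _ _ _ _
    l2_inner_add l2_inner_scal l2_inner_sym l2_inner_pos l2_inner_def l2_complete);
    intros; apply l2_ext; intros n; simpl; ring.
Defined.

Lemma sqsum_delta i : sqsum (delta i).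
Proof.
  apply (bounded_sums_series _ 1%R); [intros; apply nsq_ge0|]. intros N.
  enough (sum_n (fun n => nsq (delta i n)) N = if Compare_dec.le_lt_dec i N then 1%R else 0%R)
    by (destruct Compare_dec.le_lt_dec; lra).
  induction N as [|N IH].
  - rewrite sum_O. unfold delta, nsq.
    destruct excluded_middle_informative, Compare_dec.le_lt_dec; simpl; try lia; ring.
  - rewrite sum_Sn, IH. unfold delta, nsq, plus.
    destruct excluded_middle_informative, (Compare_dec.le_lt_dec i N),
      (Compare_dec.le_lt_dec i (S N)); simpl; try lia; ring.
Qed.

Definition l2_delta (i : nat) : l2 := exist _ _ (sqsum_delta i).

Lemma Series_single (a : nat -> R) i : (forall n, n <> i -> a n = 0%R) -> Series a = a i.
Proof.
  intros H. destruct i as [|i].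
  - rewrite Series_incr_1.
    + rewrite (Series_zero (fun k => a (S k))); [ring|]. intros; apply H; lia.
    + apply (ex_series_incr_1 a). apply (ex_series_ext (fun n => 0 * 0 ^ n)%R).
      * intros n. rewrite H by lia. apply Rmult_0_l.
      * apply (ex_series_scal_l 0%R (fun n => 0 ^ n)%R), ex_series_geom. rewrite Rabs_R0; lra.
  - rewrite (Series_incr_n_aux a (S i)) by (intros; apply H; lia).
    rewrite Series_incr_1.
    + rewrite (Series_zero (fun k => a (S i + S k)%nat)); [rewrite Nat.add_0_r; ring|].
      intros; apply H; lia.
    + apply (ex_series_incr_1 (fun k => a (S i + k)%nat)).
      apply (ex_series_ext (fun n => 0 * 0 ^ n)%R).
      * intros n. rewrite H by lia. apply Rmult_0_l.
      * apply (ex_series_scal_l 0%R (fun n => 0 ^ n)%R), ex_series_geom. rewrite Rabs_R0; lra.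
Qed.

Lemma l2_inner_delta i j : l2_inner (l2_delta i) (l2_delta j) = delta i j.
Proof.
  unfold l2_inner; simpl proj1_sig.
  rewrite (Series_single _ i), (Series_single _ i).
  - rewrite delta_eq, delta_conj. unfold delta.
    destruct (excluded_middle_informative (i = j)), (excluded_middle_informative (j = i));
    try congruence;
    unfold RtoC; simpl; f_equal; ring.
  - intros n Hn. rewrite (delta_neq i n) by auto. simpl; ring.
  - intros n Hn. rewrite (delta_neq i n) by auto. simpl; ring.
Qed.

Fixpoint embed (x : vec nat) : l2_hilbert :=
  match x with
  | [] => hzero l2_hilbert
  | (c, i) :: x' => hadd l2_hilbert (hscal l2_hilbert c (l2_delta i)) (embed x')
  end.

Lemma hinner_embed (x y : vec nat) : hinner l2_hilbert (embed x) (embed y) = vdot x y.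
Proof.
  assert (Hd : forall i, hinner l2_hilbert (l2_delta i) (embed y) = vcoef y i).
  { intros i. induction y as [|[d j] y IH]; [apply hinner_zero_r|].
    cbn [embed vcoef]. rewrite hinnerDr, hinnerZr, IH. f_equal. f_equal. apply l2_inner_delta. }
  induction x as [|[c i] x IH]; [apply hinner_zero_l|].
  cbn [embed vdot]. now rewrite hinnerDl, hinnerZl, Hd, IH.
Qed.

(** * Countable groups *)

Definition countable (T : Type) : Prop := exists c : T -> nat, forall x y, c x = c y -> x = y.

Lemma countable_image {T U : Type} (f : T -> U) :
  (forall u, exists t, f t = u) -> countable T -> countable U.
Proof.
  intros Hf [c Hc]. apply choice in Hf as [g Hg].
  exists (fun u => c (g u)). intros x y E. apply Hc in E. rewrite <- (Hg x), <- (Hg y). now f_equal.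
Qed.

(** The successor keeps the codes of nonempty lists away from [0], the code of the empty list. *)
Fixpoint code_list (l : list nat) : nat :=
  match l with
  | [] => 0
  | n :: l' => S (Cantor.to_nat (n, code_list l'))
  end.

Lemma code_list_inj l l' : code_list l = code_list l' -> l = l'.
Proof.
  revert l'; induction l as [|n l IH]; intros [|n' l']; cbn [code_list]; try congruence.
  intros E. apply eq_add_S, Cantor.to_nat_inj in E. injection E as -> E. f_equal; auto.
Qed.

Lemma countable_list {T : Type} : countable T -> countable (list T).
Proof.
  intros [c Hc]. exists (fun l => code_list (map c l)). intros x y E.
  apply code_list_inj in E. revert y E. induction x as [|a x IH]; intros [|b y]; simpl; try congruence.
  intros E. injection E as E1 E2. f_equal; auto.
Qed.

Lemma countable_sigma {V : Type} (T : V -> Type) :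
  finite_type V -> (forall v, countable (T v)) -> countable {v : V & T v}.
Proof.
  intros [l Hl] HT.
  assert (Hc : exists c : forall v, T v -> nat, forall v x y, c v x = c v y -> x = y).
  { exists (fun v => proj1_sig (constructive_indefinite_description _ (HT v))).
    intros v. exact (proj2_sig (constructive_indefinite_description _ (HT v))). }
  destruct Hc as [c Hc].
  assert (Hn : forall v, exists n, nth_error l n = Some v) by (intros; now apply In_nth_error).
  apply choice in Hn as [k Hk].
  exists (fun p => Cantor.to_nat (k (projT1 p), c (projT1 p) (projT2 p))).
  intros [v x] [w y] E. apply Cantor.to_nat_inj in E.
  injection E as E1 E2.
  assert (Hvw : v = w) by (apply (f_equal (nth_error l)) in E1; simpl in E1; rewrite !Hk in E1; congruence).
  subst w. simpl in E2. apply Hc in E2. now subst.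
Qed.

Lemma countable_enum {T : Type} (t0 : T) :
  countable T -> exists e : nat -> T, forall t, exists n, e n = t.
Proof.
  intros [c Hc].
  assert (H : forall n, exists t, (exists t', c t' = n) -> c t = n).
  { intros n. destruct (classic (exists t', c t' = n)) as [[t Ht]|Hn]; [now exists t|].
    exists t0. tauto. }
  apply choice in H as [e He]. exists e. intros t. exists (c t). apply Hc, He. eauto.
Qed.

Lemma countable_finitely_generated (G : group) : finitely_generated G -> countable G.
Proof.
  intros [gens Hgens].
  (* A number codes a generator with an inversion flag: its parity is the flag and its half the
     position in [gens], with [gone G] as the value beyond the end. *)
  apply (countable_image (fun l : list nat =>
    eval_word G (map (fun n => (Nat.odd n, nth (Nat.div2 n) gens (gone G))) l))).
  - intros g. destruct (Hgens g) as [w [Hw ->]]. clear Hgens.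
    induction w as [|[b s] w IH]; [now exists []|].
    destruct IH as [l Hl]; [intros; apply Hw; now right|].
    destruct (In_nth gens s (gone G)) as [k [_ Hk]]; [apply (Hw (b, s)); now left|].
    exists ((if b then 1 else 0) + 2 * k :: l)%nat. cbn [map eval_word]. rewrite Hl.
    f_equal. rewrite <- Hk. destruct b.
    + rewrite Nat.odd_add_mul_2. replace (1 + 2 * k)%nat with (S (2 * k)) by lia.
      now rewrite Nat.div2_succ_double.
    + rewrite Nat.odd_add_mul_2, Nat.add_0_l, Nat.div2_double. reflexivity.
  - apply countable_list. now exists (fun n => n).
Qed.

Lemma B2_le_of_vec (G : group) (I : Type) (phi : G -> C) (A B : G -> vec I) (M : R) :
  countable G -> (0 <= M)%R ->
  (forall g, exists t, vnorm2 (A g) t /\ (t <= M)%R) ->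
  (forall g, exists t, vnorm2 (B g) t /\ (t <= M)%R) ->
  (forall g h, phi (gmul G (ginv G h) g) = vdot (A g) (B h)) ->
  B2_le G phi M.
Proof.
  intros [c Hc] HM HA HB Hphi eps He.
  (* Only countably many indices occur, so they can be renamed into [nat]. *)
  set (used := fun i gk => nth_error (map snd (A (fst gk) ++ B (fst gk))) (snd gk) = Some i).
  assert (Hidx : forall i : I, exists n : nat, (exists gk, used i gk) ->
    exists gk, used i gk /\ n = Cantor.to_nat (c (fst gk), snd gk)).
  { intros i. destruct (classic (exists gk, used i gk)) as [[gk Hg]|Hn].
    - exists (Cantor.to_nat (c (fst gk), snd gk)). intros _. now exists gk.
    - exists 0%nat. tauto. }
  apply choice in Hidx as [idx Hidx].
  assert (Hinj : forall i j, (exists gk, used i gk) -> (exists gk, used j gk) ->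
    idx i = idx j -> i = j).
  { intros i j Hi Hj E. destruct (Hidx i Hi) as [[g k] [U1 E1]], (Hidx j Hj) as [[g' k'] [U2 E2]].
    rewrite E1, E2 in E. apply Cantor.to_nat_inj in E.
    injection E as Eg Ek. apply Hc in Eg. subst.
    unfold used in *. congruence. }
  assert (HuA : forall g i, In i (map snd (A g)) -> exists gk, used i gk).
  { intros g i Hi. destruct (In_nth_error (map snd (A g ++ B g)) i) as [k Hk].
    - rewrite map_app. apply in_or_app. now left.
    - now exists (g, k). }
  assert (HuB : forall g i, In i (map snd (B g)) -> exists gk, used i gk).
  { intros g i Hi. destruct (In_nth_error (map snd (A g ++ B g)) i) as [k Hk].
    - rewrite map_app. apply in_or_app. now right.
    - now exists (g, k). }
  exists l2_hilbert, (fun g => embed (vmap idx (A g))), (fun g => embed (vmap idx (B g))), (sqrt M), (sqrt M).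
  repeat split.
  - intros g. unfold hnorm. apply sqrt_le_1_alt. rewrite hinner_embed, vdot_map_in by eauto.
    destruct (HA g) as [t [[-> _] Ht]]. exact Ht.
  - intros g. unfold hnorm. apply sqrt_le_1_alt. rewrite hinner_embed, vdot_map_in by eauto.
    destruct (HB g) as [t [[-> _] Ht]]. exact Ht.
  - rewrite sqrt_sqrt; lra.
  - intros g h. now rewrite hinner_embed, vdot_map_in, Hphi by eauto.
Qed.

(** * Multipliers of a vertex group *)

Section GroupLemmas.
Variable G : group.
Local Notation "x ** y" := (gmul G x y) (at level 40, left associativity).
Local Notation "x ^-1" := (ginv G x) (at level 30).
Local Notation e := (gone G).

Lemma gmulVK (x y : G) : x^-1 ** (x ** y) = y.
Proof. now rewrite gmulA, gmulVl, gmul1l. Qed.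

Lemma gmulKV (x y : G) : x ** (x^-1 ** y) = y.
Proof. now rewrite gmulA, gmulVr, gmul1l. Qed.

Lemma gmul_cancel (x y z : G) : x ** y = x ** z -> y = z.
Proof. intros E. rewrite <- (gmulVK x y), E. apply gmulVK. Qed.

Lemma ginv_one : e^-1 = e.
Proof. now rewrite <- (gmul1l G (e^-1)), gmulVr. Qed.

Lemma ginvM (x y : G) : (x ** y)^-1 = y^-1 ** x^-1.
Proof.
  apply (gmul_cancel (x ** y)). rewrite gmulVr, <- gmulA, (gmulA G y), gmulVr, gmul1l.
  symmetry; apply gmulVr.
Qed.

Lemma ginvK (x : G) : (x^-1)^-1 = x.
Proof. apply (gmul_cancel (x^-1)). now rewrite gmulVr, gmulVl. Qed.

Lemma gdiv_eq_one (x y : G) : y^-1 ** x = e -> x = y.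
Proof. intros E. rewrite <- (gmulKV y x), E. apply gmul1r. Qed.

Lemma ginv_eq_one (x : G) : x^-1 = e -> x = e.
Proof. intros E. now rewrite <- (ginvK x), E, ginv_one. Qed.

Lemma gdiv_translate (z x y : G) : (z ** y)^-1 ** (z ** x) = y^-1 ** x.
Proof. now rewrite ginvM, <- gmulA, gmulVK. Qed.
End GroupLemmas.

Lemma hom_one (G K : group) (f : G -> K) : is_hom G K f -> f (gone G) = gone K.
Proof.
  intros Hf. apply (gmul_cancel K (f (gone G))). now rewrite <- Hf, gmul1l, gmul1r.
Qed.

Lemma hom_inv (G K : group) (f : G -> K) x : is_hom G K f -> f (ginv G x) = ginv K (f x).
Proof.
  intros Hf. apply (gmul_cancel K (f x)). rewrite <- Hf, !gmulVr. now apply hom_one.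
Qed.

(* The finitary form of [Lambda_WH G <= 1]. *)
Definition locally_WH1 (G : group) : Prop :=
  forall (F : list G) (theta : R), (0 < theta)%R -> exists phi : G -> C,
    vanishes_at_infinity G phi /\ B2_le G phi (1 + theta) /\
    forall g, In g F -> (Cmod (phi g - RtoC 1) < theta)%R.

(** As the infimum is 1, some admissible constant lies below [1 + theta]. A single late member of
    its sequence then serves all of the finite set [F]. *)
Lemma locally_WH1_of_Lambda (G : group) : Lambda_WH_eq G 1 -> locally_WH1 G.
Proof.
  intros [_ [Hinf _]] F theta Ht.
  assert (HB : exists B, WH_constant G B /\ (B < 1 + theta)%R).
  { apply NNPP. intros Hn. enough (1 + theta <= 1)%R by lra. apply Hinf. intros B HB.
    destruct (Rle_lt_dec (1 + theta) B) as [|Hlt]; trivial. exfalso; eauto. }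
  destruct HB as [B [[_ [phi [Hv [Hlim HB]]]] HBt]].
  assert (HN : exists N, forall n, (N <= n)%nat -> forall g, In g F ->
    (Cmod (phi n g - RtoC 1) < theta)%R).
  { clear - Hlim Ht. induction F as [|g F [N IH]]; [exists 0%nat; simpl; tauto|].
    destruct (Hlim g theta Ht) as [N' HN']. exists (Nat.max N N'). intros n Hn h [<-|Hh].
    - apply HN'; lia.
    - apply IH; trivial; lia. }
  destruct HN as [N HN]. exists (phi N). split; [apply Hv|]. split; [|now apply HN].
  intros eps He. destruct (HB N eps He) as [H [a [b [Ma [Mb [? [? [? ?]]]]]]]].
  exists H, a, b, Ma, Mb. repeat split; trivial. lra.
Qed.

Lemma hnorm_sq (H : hilbert) (x : H) : (hnorm H x * hnorm H x)%R = Re (hinner H x x).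
Proof. apply sqrt_sqrt, hinner_pos. Qed.

Lemma hnorm_sq_le (H : hilbert) (x : H) M :
  (hnorm H x <= M -> Re (hinner H x x) <= M * M)%R.
Proof.
  intros Hx. rewrite <- hnorm_sq. pose proof (sqrt_pos (Re (hinner H x x))).
  unfold hnorm in *. nra.
Qed.

Lemma Cmod_hinner_le (H : hilbert) (x y : H) Ma Mb :
  (hnorm H x <= Ma)%R -> (hnorm H y <= Mb)%R -> (Cmod (hinner H x y) <= Ma * Mb)%R.
Proof.
  intros Hx Hy. pose proof (cauchy_schwarz H x y) as CS. rewrite <- !hnorm_sq in CS.
  assert (Px : (0 <= hnorm H x)%R) by apply sqrt_pos.
  assert (Py : (0 <= hnorm H y)%R) by apply sqrt_pos.
  pose proof (Cmod_ge_0 (hinner H x y)) as Pc.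
  apply Rle_trans with (hnorm H x * hnorm H y)%R; [|now apply Rmult_le_compat].
  apply Rsqr_incr_0; unfold Rsqr; nra.
Qed.

Lemma Re_hinner_scal (H : hilbert) k (x : H) :
  Re (hinner H (hscal H k x) (hscal H k x)) = (Cmod k * Cmod k * Re (hinner H x x))%R.
Proof.
  rewrite hinnerZl, hinnerZr, Cmult_assoc, mul_conj_RtoC, hinner_norm, <- RtoC_mult. reflexivity.
Qed.

(** The value at the identity is close to 1, so dividing by it costs little. Rescaling [alpha]
    against [beta] then bounds each of the two norms separately, and not just their product. *)
Lemma normalized_factorization (G : group) : locally_WH1 G ->
  forall (F : list G) (eps : R), (0 < eps)%R ->
  exists (phi : G -> C) (H : hilbert) (alpha beta : G -> H),
    vanishes_at_infinity G phi /\ phi (gone G) = RtoC 1 /\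
    (forall g, In g F -> (Cmod (phi g - RtoC 1) < eps)%R) /\
    (forall g, (Re (hinner H (alpha g) (alpha g)) <= 1 + eps)%R) /\
    (forall g, (Re (hinner H (beta g) (beta g)) <= 1 + eps)%R) /\
    (forall g h, phi (gmul G (ginv G h) g) = hinner H (alpha g) (beta h)).
Proof.
  (* The product of the two bounds will be at most [1 + 2 th] and [Cmod c] at least [1 - th]. For
     [th <= 1/4], the errors after division by [c] stay within [6 th]. *)
  intros HG F eps He. set (th := Rmin (1 / 4) (eps / 6)).
  assert (Hth : (0 < th)%R) by (apply Rmin_glb_lt; lra).
  assert (Hth1 : (th <= 1 / 4)%R) by apply Rmin_l.
  assert (Hth2 : (6 * th <= eps)%R) by (unfold th; pose proof (Rmin_r (1 / 4) (eps / 6)); lra).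
  destruct (HG (gone G :: F) th Hth) as [f [Hv [HB HF]]].
  destruct (HB th Hth) as [H [al [be [Ma [Mb [HMa [HMb [HM Hf]]]]]]]].
  set (c := f (gone G)).
  assert (Hc1 : (Cmod (c - RtoC 1) < th)%R) by (apply HF; now left).
  assert (Hc2 : (1 - th <= Cmod c)%R).
  { pose proof (Cmod_triangle c (- (c - RtoC 1))) as T. rewrite Cmod_opp in T.
    replace (c + - (c - RtoC 1)) with (RtoC 1) in T by ring. rewrite Cmod_1 in T. lra. }
  assert (Hc0 : c <> RtoC 0) by (intros E; rewrite E, Cmod_0 in Hc2; lra).
  assert (PMa : (0 <= Ma)%R) by (apply Rle_trans with (hnorm H (al (gone G))); [apply sqrt_pos|trivial]).
  assert (PMb : (0 <= Mb)%R) by (apply Rle_trans with (hnorm H (be (gone G))); [apply sqrt_pos|trivial]).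
  assert (Hcm : (Cmod c <= Ma * Mb)%R).
  { unfold c. rewrite <- (gmulVl G (gone G)), Hf. now apply Cmod_hinner_le. }
  assert (PMa' : (0 < Ma)%R).
  { destruct (Rle_lt_or_eq_dec 0 Ma PMa) as [|E]; trivial. rewrite <- E in Hcm. lra. }
  assert (PMb' : (0 < Mb)%R).
  { destruct (Rle_lt_or_eq_dec 0 Mb PMb) as [|E]; trivial. rewrite <- E in Hcm. lra. }
  assert (Hratio : (Ma * Mb / Cmod c <= 1 + eps)%R).
  { apply Rle_trans with (1 + 6 * th)%R; [|lra].
    apply Rmult_le_reg_r with (Cmod c); [lra|].
    replace (Ma * Mb / Cmod c * Cmod c)%R with (Ma * Mb)%R by (field; lra). nra. }
  (* This [k] balances the two norms: both become [Ma * Mb / |c|]. *)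
  set (k := sqrt (Cmod c * Mb / Ma)).
  assert (Hk : (0 < Cmod c * Mb / Ma)%R) by (apply Rdiv_lt_0_compat; [apply Rmult_lt_0_compat; lra|trivial]).
  assert (Hk2 : (k * k = Cmod c * Mb / Ma)%R) by (apply sqrt_sqrt; lra).
  assert (Pk : (0 < k)%R) by now apply sqrt_lt_R0.
  exists (fun g => f g / c), H, (fun g => hscal H (RtoC k / c) (al g)),
    (fun g => hscal H (RtoC (/ k)) (be g)).
  repeat split.
  - intros e0 He0. destruct (Hv (e0 * Cmod c)%R) as [l Hl]; [apply Rmult_lt_0_compat; lra|].
    exists l. intros g Hg. apply Hl. rewrite Cmod_div in Hg by trivial.
    replace (Cmod (f g)) with (Cmod (f g) / Cmod c * Cmod c)%R by (field; lra).
    apply Rmult_le_compat_r; lra.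
  - now apply Cinv_r.
  - intros g Hg. specialize (HF g (or_intror Hg)).
    replace (f g / c - RtoC 1) with ((f g - RtoC 1 + - (c - RtoC 1)) / c) by (field; trivial).
    rewrite Cmod_div by trivial. apply Rmult_lt_reg_r with (Cmod c); [lra|].
    match goal with |- (?x / Cmod c * Cmod c < _)%R =>
      replace (x / Cmod c * Cmod c)%R with x by (field; lra) end.
    eapply Rle_lt_trans; [apply Cmod_triangle|]. rewrite Cmod_opp. nra.
  - intros g. rewrite Re_hinner_scal. rewrite Cmod_div, Cmod_R, Rabs_pos_eq by (trivial; lra).
    eapply Rle_trans; [|apply Hratio].
    replace (k / Cmod c * (k / Cmod c))%R with (Mb / (Ma * Cmod c))%R
      by (replace (k / Cmod c * (k / Cmod c))%R with (k * k / (Cmod c * Cmod c))%R by (field; lra);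
          rewrite Hk2; field; lra).
    pose proof (hnorm_sq_le H (al g) Ma (HMa g)).
    replace (Ma * Mb / Cmod c)%R with (Mb / (Ma * Cmod c) * (Ma * Ma))%R by (field; lra).
    apply Rmult_le_compat_l; trivial. apply Rlt_le, Rdiv_lt_0_compat; trivial.
    apply Rmult_lt_0_compat; lra.
  - intros g. rewrite Re_hinner_scal. rewrite Cmod_R, Rabs_pos_eq by now apply Rlt_le, Rinv_0_lt_compat.
    eapply Rle_trans; [|apply Hratio].
    replace (/ k * / k)%R with (Ma / (Cmod c * Mb))%R
      by (replace (/ k * / k)%R with (/ (k * k))%R by (field; lra);
          rewrite Hk2; field; lra).
    pose proof (hnorm_sq_le H (be g) Mb (HMb g)).
    replace (Ma * Mb / Cmod c)%R with (Ma / (Cmod c * Mb) * (Mb * Mb))%R by (field; lra).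
    apply Rmult_le_compat_l; trivial. apply Rlt_le, Rdiv_lt_0_compat; trivial.
    apply Rmult_lt_0_compat; lra.
  - intros g h. rewrite hinnerZl, hinnerZr, conj_RtoC, <- Hf, RtoC_inv by lra.
    field. split; trivial. intros E. apply RtoC_inj in E. lra.
Qed.

(** When [<a, b> = 1], this is the oblique projection along [a] onto the orthogonal complement of
    [b]. *)
Definition hproj_compl (H : hilbert) (x a b : H) : H :=
  hsub H x (hscal H (hinner H x b) a).

(* Since [a] and [b] almost coincide, removing the [a]-component measured with
   [b] is almost an orthogonal projection. *)
Lemma hproj_compl_norm (H : hilbert) (x a b : H) (s : R) :
  (0 < s <= 1)%R -> hinner H a b = RtoC 1 ->
  (Re (hinner H a a) <= 1 + s * s)%R -> (Re (hinner H b b) <= 1 + s * s)%R ->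
  (Re (hinner H x x) <= 1 + s * s)%R ->
  (Cmod (hinner H x b) <= 1 + s * s)%R /\
  (Re (hinner H (hproj_compl H x a b) (hproj_compl H x a b)) <=
    1 - Cmod (hinner H x b) * Cmod (hinner H x b) + 13 * s)%R.
Proof.
  intros Hs Hab Ha Hb Hx. set (p := hinner H x b).
  assert (Hba : hinner H b a = RtoC 1) by (rewrite hinner_sym, Hab; apply conj_RtoC).
  assert (Pa : (0 <= Re (hinner H a a))%R) by apply hinner_pos.
  assert (Pb : (0 <= Re (hinner H b b))%R) by apply hinner_pos.
  assert (Px : (0 <= Re (hinner H x x))%R) by apply hinner_pos.
  pose proof (Cmod_ge_0 p) as Pp.
  assert (Hp : (Cmod p <= 1 + s * s)%R).
  { pose proof (cauchy_schwarz H x b) as CS. fold p in CS.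
    apply Rsqr_incr_0; unfold Rsqr; nra. }
  (* [d] measures how far [a] and [b] are apart: [|d|^2 = |a|^2 + |b|^2 - 2 <= 2 s^2], and
     Cauchy-Schwarz turns this into [|q| <= 2 s]. *)
  split; trivial. set (d := hsub H a b). set (q := hinner H x d).
  assert (Hd : (Re (hinner H d d) <= 2 * (s * s))%R).
  { unfold d, hsub. rewrite !hinnerDl, !hinnerDr, !hinnerZl, !hinnerZr, Hab, Hba.
    destruct (hinner H a a), (hinner H b b); simpl in *. lra. }
  assert (Hq : (Cmod q <= 2 * s)%R).
  { pose proof (cauchy_schwarz H x d) as CS. fold q in CS.
    assert (Pd : (0 <= Re (hinner H d d))%R) by apply hinner_pos.
    pose proof (Cmod_ge_0 q). apply Rsqr_incr_0; unfold Rsqr; try nra.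
    apply Rle_trans with ((1 + s * s) * (2 * (s * s)))%R; [|assert (s * s <= 1)%R by nra; nra].
    eapply Rle_trans; [apply CS|]. apply Rmult_le_compat; lra. }
  assert (Hxa : hinner H x a = p + q).
  { unfold p, q, d, hsub. rewrite hinnerDr, hinnerZr, Copp_conj, conj_RtoC. ring. }
  assert (E : Re (hinner H (hproj_compl H x a b) (hproj_compl H x a b)) =
    (Re (hinner H x x) - 2 * (Cmod p * Cmod p) - 2 * Re (Cconj p * q)
       + Cmod p * Cmod p * Re (hinner H a a))%R).
  { unfold hproj_compl, hsub. fold p. rewrite !hinnerDl, !hinnerDr, !hinnerZl, !hinnerZr.
    rewrite (hinner_sym H x a), Hxa, (hinner_norm H x), (hinner_norm H a).
    replace (Cmod p * Cmod p)%R with (Re p * Re p + Im p * Im p)%R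
      by (pose proof (Cmod2_alt p); lra).
    destruct p, q; simpl. ring. }
  rewrite E.
  (* The error [13 s] is made up of [s] from [|x|^2], [8 s] from the mixed term and [4 s] from the
     excess of [|a|^2] over 1. *)
  assert (Hre : (Rabs (Re (Cconj p * q)) <= Cmod p * Cmod q)%R).
  { rewrite <- (Cmod_conj p), <- Cmod_mult. apply re_le_Cmod. }
  assert (Hre2 : (- Re (Cconj p * q) <= Cmod p * Cmod q)%R).
  { eapply Rle_trans; [|exact Hre]. rewrite <- Rabs_Ropp. apply Rle_abs. }
  assert (Hpq : (Cmod p * Cmod q <= 4 * s)%R).
  { replace (4 * s)%R with (2 * (2 * s))%R by ring. pose proof (Cmod_ge_0 q).
    apply Rmult_le_compat; trivial. nra. }
  assert (Hpp : (Cmod p * Cmod p * Re (hinner H a a) <= Cmod p * Cmod p * (1 + s * s))%R)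
    by (apply Rmult_le_compat_l; [nra|trivial]).
  assert (Hs1 : (s * s <= s)%R) by nra.
  assert (Hp4 : (Cmod p * Cmod p <= 4)%R) by (assert (Cmod p <= 2)%R by lra; nra).
  assert (Hss : (Cmod p * Cmod p * (s * s) <= 4 * s)%R)
    by (apply Rmult_le_compat; trivial; nra).
  lra.
Qed.

(** Exchanging [a] and [b] in the second projection collapses the mixed terms to a single one. For a
    factorization of [phi], with [a] and [b] its vectors at the identity, the right side is the
    centred kernel of [phi]. *)
Lemma hproj_compl_inner (H : hilbert) (x y a b : H) : hinner H a b = RtoC 1 ->
  hinner H (hproj_compl H x a b) (hproj_compl H y b a) =
  hinner H x y - hinner H x b * hinner H a y.
Proof.
  intros Hab. unfold hproj_compl, hsub.
  rewrite !hinnerDl, !hinnerDr, !hinnerZl, !hinnerZr, Hab, Copp_conj, conj_RtoC.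
  rewrite <- (hinner_sym H y a). ring.
Qed.

Lemma gram_schmidt_countable (H : hilbert) (T : Type) (u : T -> H) :
  countable T -> exists c : T -> vec nat, forall s t, vdot (c s) (c t) = hinner H (u s) (u t).
Proof.
  intros HT. destruct (classic (inhabited T)) as [[t0]|Hn].
  - destruct (countable_enum t0 HT) as [e He]. apply choice in He as [n Hn].
    destruct (gram_schmidt H (fun k => u (e k))) as [c Hc].
    exists (fun t => c (n t)). intros s t. now rewrite Hc, !Hn.
  - exists (fun _ => []). intros s. exfalso; apply Hn; now constructor.
Qed.

(* The centred kernel of [psi] factors with norms that telescope along words. *)
Record split_multiplier (G : group) (I : Type) (psi : G -> C) (a b : G -> vec I) (t theta : R) : Prop := {
  sm_one : psi (gone G) = RtoC 1;
  sm_t : (0 <= t < 1)%R;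
  sm_bound : forall x, x <> gone G -> (Cmod (psi x) <= t)%R;
  sm_kernel : forall x y, x <> gone G -> y <> gone G ->
    vdot (a x) (b y) = psi (gmul G (ginv G y) x) - psi x * psi (ginv G y);
  sm_norm_a : forall x, x <> gone G -> exists s, vnorm2 (a x) s /\
    (s <= (1 - Cmod (psi x) * Cmod (psi x)) * (1 + theta))%R;
  sm_norm_b : forall x, x <> gone G -> exists s, vnorm2 (b x) s /\
    (s <= (1 - Cmod (psi (ginv G x)) * Cmod (psi (ginv G x))) * (1 + theta))%R }.

(** Take [psi = r phi + (1 - r) delta_1], with [r] slightly below 1. Its centred kernel is [r^2]
    times that of [phi], plus [r (1 - r) phi (y^-1 x)], plus [1 - r] on the diagonal; the three
    summands of [av] and [bv] realise these three parts. Since [r < 1], the quantity [1 - |psi x|^2]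
    is bounded below for [x] other than 1, so additive errors can be absorbed into the factor
    [1 + theta]. *)
Lemma exists_split_multiplier (G : group) : countable G -> locally_WH1 G ->
  forall (F : list G) (theta : R), (0 < theta <= 1)%R ->
  exists (psi : G -> C) (I : Type) (a b : G -> vec I) (t : R),
    vanishes_at_infinity G psi /\
    (forall g, In g F -> (Cmod (psi g - RtoC 1) < theta)%R) /\
    split_multiplier G I psi a b t theta.
Proof.
  intros HcG HG F theta Hth. set (tau := (theta / 4)%R). set (r := (1 - tau)%R).
  (* The errors will add up to at most [14 s = theta (tau / 2)], and [tau / 2] is the lower bound
     for [1 - |psi x|^2]. *)
  set (s := (theta * tau / 28)%R).
  assert (Htau : (0 < tau <= 1 / 4)%R) by (unfold tau; lra).
  assert (Hs : (0 < s <= 1)%R) by (unfold s; split; nra).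
  assert (Hs14 : (14 * s <= theta * (tau / 2))%R) by (unfold s; lra).
  assert (Hstau : (s <= tau / 2)%R) by (unfold s; nra).
  assert (Hss : (0 < s * s)%R) by nra.
  destruct (normalized_factorization G HG F (s * s) Hss)
    as [phi [H [al [be [Hv [H1 [HF [Ha [Hb Hphi]]]]]]]]].
  set (e := gone G) in *.
  set (psi := fun g => if excluded_middle_informative (g = e) then RtoC 1 else RtoC r * phi g).
  assert (Hpsi1 : psi e = RtoC 1) by (unfold psi; destruct excluded_middle_informative; congruence).
  assert (Hpsi2 : forall x, x <> e -> psi x = RtoC r * phi x)
    by (intros; unfold psi; destruct excluded_middle_informative; congruence).
  assert (Hpm : forall x, x <> e -> Cmod (psi x) = (r * Cmod (phi x))%R).
  { intros x Hx. rewrite Hpsi2, Cmod_mult, Cmod_R, Rabs_pos_eq; trivial. unfold r; lra. }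
  assert (Hab : hinner H (al e) (be e) = RtoC 1).
  { rewrite <- Hphi. unfold e. rewrite gmulVl. exact H1. }
  assert (Hba : hinner H (be e) (al e) = RtoC 1) by (rewrite hinner_sym, Hab; apply conj_RtoC).
  assert (Hxb : forall x, hinner H (al x) (be e) = phi x).
  { intros x. rewrite <- Hphi. unfold e. now rewrite ginv_one, gmul1l. }
  assert (Hay : forall y, hinner H (al e) (be y) = phi (ginv G y)).
  { intros y. rewrite <- Hphi. unfold e. now rewrite gmul1r. }
  assert (Hya : forall y, Cmod (hinner H (be y) (al e)) = Cmod (phi (ginv G y))).
  { intros y. rewrite hinner_sym, Hay. apply Cmod_conj. }
  (* All four families form one countable family, so that a single Gram-Schmidt process preserves
     the inner products between them. The first flag marks projected vectors, the second separates
     [al] from [be]. *)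
  set (u := fun p : {_ : bool * bool & G} => let x := projT2 p in
    match projT1 p with
    | (true, true) => hproj_compl H (al x) (al e) (be e)
    | (true, false) => hproj_compl H (be x) (be e) (al e)
    | (false, true) => al x
    | (false, false) => be x
    end).
  destruct (gram_schmidt_countable H _ u) as [c Hc].
  { apply countable_sigma; trivial.
    exists [(true, true); (true, false); (false, true); (false, false)].
    intros [[] []]; simpl; auto. }
  set (ix := fun b1 b2 (x : G) => existT (fun _ : bool * bool => gcar G) (b1, b2) x).
  set (k2 := RtoC (sqrt (r * (1 - r)))). set (k3 := RtoC (sqrt (1 - r))).
  assert (Hr2 : (0 <= r * (1 - r))%R) by (unfold r; nra).
  assert (Hr3 : (0 <= 1 - r)%R) by (unfold r; lra).
  set (av := fun x => vsum (vscal (RtoC r) (c (ix true true x)))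
                      (vsum (vscal k2 (c (ix false true x))) [(k3, x)])).
  set (bv := fun x => vsum (vscal (RtoC r) (c (ix true false x)))
                      (vsum (vscal k2 (c (ix false false x))) [(k3, x)])).
  assert (Hnorm : forall b1 b2 x, vnorm2 (c (ix b1 b2 x)) (Re (hinner H (u (ix b1 b2 x)) (u (ix b1 b2 x))))).
  { intros b1 b2 x. split; [|apply hinner_pos]. rewrite Hc. apply hinner_norm. }
  assert (Hk2 : (Cmod k2 * Cmod k2 = r * (1 - r))%R).
  { unfold k2. rewrite Cmod_R, Rabs_pos_eq by apply sqrt_pos. now apply sqrt_sqrt. }
  assert (Hk3 : (Cmod k3 * Cmod k3 = 1 - r)%R).
  { unfold k3. rewrite Cmod_R, Rabs_pos_eq by apply sqrt_pos. now apply sqrt_sqrt. }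
  assert (Hkr : (Cmod (RtoC r) * Cmod (RtoC r) = r * r)%R).
  { rewrite Cmod_R, Rabs_pos_eq; trivial. unfold r; lra. }
  (* [n1] and [n2] stand for the squared norms of the projected and the plain vector, [m] for the
     modulus of [phi] at the point or its inverse. Without error terms the left side would be
     exactly [1 - r^2 m^2]. *)
  assert (Harith : forall n1 n2 m : R, (0 <= m <= 1 + s * s)%R -> (n1 <= 1 - m * m + 13 * s)%R ->
    (n2 <= 1 + s * s)%R ->
    (r * r * n1 + (r * (1 - r) * n2 + (1 - r)) <= (1 - r * m * (r * m)) * (1 + theta))%R).
  { intros n1 n2 m Hm Hn1 Hn2.
    assert (E1 : (r * r * n1 <= r * r * (1 - m * m + 13 * s))%R) by (apply Rmult_le_compat_l; [nra|lra]).
    assert (E2 : (r * (1 - r) * n2 <= r * (1 - r) * (1 + s * s))%R) by (apply Rmult_le_compat_l; lra).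
    assert (E3 : (r * r * (13 * s) <= 13 * s)%R) by (assert (r * r <= 1)%R by (unfold r; nra); nra).
    assert (E4 : (r * (1 - r) * (s * s) <= s)%R).
    { assert (r * (1 - r) <= 1)%R by (unfold r; nra). nra. }
    assert (Hrm : (0 <= r * m <= 1 - tau / 2)%R).
    { split; [apply Rmult_le_pos; unfold r; lra|]. apply Rle_trans with (r * (1 + tau / 2))%R; [|unfold r; nra].
      apply Rmult_le_compat_l; [unfold r; lra|]. nra. }
    assert (E5 : (tau / 2 <= 1 - r * m * (r * m))%R).
    { assert (r * m * (r * m) <= r * m * 1)%R by (apply Rmult_le_compat_l; lra). lra. }
    assert (E6 : (theta * (tau / 2) <= theta * (1 - r * m * (r * m)))%R)
      by (apply Rmult_le_compat_l; lra).
    nra. }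
  (* The bound [t] comes from [r (1 + s^2) <= (1 - tau) (1 + tau / 2) <= 1 - tau / 2]. *)
  exists psi, (nat + (nat + G))%type, av, bv, (1 - tau / 2)%R. split; [|split].
  - intros eps He. destruct (Hv eps He) as [l Hl]. exists (e :: l). intros g Hg.
    destruct (classic (g = e)) as [->|Hn]; [now left|right]. apply Hl.
    rewrite Hpm in Hg by trivial. pose proof (Cmod_ge_0 (phi g)). unfold r in Hg. nra.
  - intros g Hg. destruct (classic (g = e)) as [->|Hn].
    + rewrite Hpsi1. replace (RtoC 1 - RtoC 1) with (RtoC 0) by ring. rewrite Cmod_0. lra.
    + rewrite Hpsi2 by trivial.
      replace (RtoC r * phi g - RtoC 1) with (RtoC r * (phi g - RtoC 1) + RtoC (- tau)).
      * eapply Rle_lt_trans; [apply Cmod_triangle|].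
        rewrite Cmod_mult, !Cmod_R, Rabs_Ropp, !Rabs_pos_eq by (unfold r; lra).
        specialize (HF g Hg). pose proof (Cmod_ge_0 (phi g - RtoC 1)). unfold r, tau in *. nra.
      * unfold r. rewrite RtoC_minus, RtoC_opp. ring.
  - split; trivial.
    + lra.
    + intros x Hx. rewrite Hpm by trivial. rewrite <- Hxb.
      destruct (hproj_compl_norm H (al x) (al e) (be e) s) as [Hm _]; trivial.
      pose proof (Cmod_ge_0 (hinner H (al x) (be e))).
      apply Rle_trans with (r * (1 + tau / 2))%R; [|unfold r; nra].
      apply Rmult_le_compat_l; [unfold r; lra|]. nra.
    + intros x y Hx Hy. unfold av, bv.
      rewrite !vdot_vsum, !vdot_scal_l, !vdot_scal_r, !Hc. unfold u, ix. cbn [projT1 projT2].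
      rewrite hproj_compl_inner, Hxb, Hay, <- Hphi by trivial.
      assert (Hy' : ginv G y <> e) by (intros E; now apply Hy, ginv_eq_one).
      rewrite (Hpsi2 x), (Hpsi2 (ginv G y)) by trivial.
      unfold k2, k3. cbn [vdot vcoef]. rewrite !conj_RtoC.
      replace (psi (gmul G (ginv G y) x)) with
        (RtoC r * phi (gmul G (ginv G y) x) + (RtoC 1 - RtoC r) * delta x y).
      * set (w := phi (gmul G (ginv G y) x)).
        transitivity (RtoC r * RtoC r * (w - phi x * phi (ginv G y)) +
          RtoC (sqrt (r * (1 - r)) * sqrt (r * (1 - r))) * w +
          RtoC (sqrt (1 - r) * sqrt (1 - r)) * delta x y).
        { rewrite !RtoC_mult. ring. }
        rewrite !sqrt_sqrt, RtoC_mult, RtoC_minus by trivial. ring.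
      * destruct (classic (x = y)) as [->|Hn].
        -- rewrite gmulVl, delta_eq. fold e. rewrite Hpsi1, H1. ring.
        -- rewrite delta_neq, Hpsi2 by (trivial; intros E; now apply Hn, gdiv_eq_one). ring.
    + intros x Hx. eexists. split.
      * apply vnorm2_vsum; [apply vnorm2_scal, Hnorm|].
        apply vnorm2_vsum; [apply vnorm2_scal, Hnorm|apply vnorm2_single].
      * rewrite Hkr, Hk2, Hk3, Hpm by trivial. unfold u, ix. cbn [projT1 projT2].
        destruct (hproj_compl_norm H (al x) (al e) (be e) s) as [Hm Hn]; trivial.
        rewrite Hxb in *. apply Harith; trivial. split; trivial. apply Cmod_ge_0.
    + intros x Hx. assert (Hx' : ginv G x <> e) by (intros E; now apply Hx, ginv_eq_one).
      eexists. split.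
      * apply vnorm2_vsum; [apply vnorm2_scal, Hnorm|].
        apply vnorm2_vsum; [apply vnorm2_scal, Hnorm|apply vnorm2_single].
      * rewrite Hkr, Hk2, Hk3, Hpm by trivial. unfold u, ix. cbn [projT1 projT2].
        destruct (hproj_compl_norm H (be x) (be e) (al e) s) as [Hm Hn]; trivial.
        rewrite Hya in *. apply Harith; trivial. split; trivial. apply Cmod_ge_0.
Qed.

(** * Kernels on words *)

Section Words.
Variables (G : group) (X : Type).
Local Notation word := (list (X * G)).

Fixpoint wprod (f : G -> C) (s : word) : C :=
  match s with
  | [] => RtoC 1
  | (_, g) :: s' => f g * wprod f s'
  end.

Definition nontrivial (s : word) : Prop := forall p, In p s -> snd p <> gone G.

Section Telescope.
Variables (I : Type) (f : G -> C) (a : G -> vec I).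

(** A basis index consists of the prefix before a syllable, the label of that syllable and an index
    in [I]. Two words thus interact only along their common prefix and at the next syllable, if its
    labels agree. *)
Fixpoint tele (s : word) : vec (word * X * I) :=
  match s with
  | [] => []
  | (x, g) :: s' =>
      vmap (fun i => ([], x, i)) (vscal (wprod f s') (a g)) ++
      vmap (fun q => ((x, g) :: fst (fst q), snd (fst q), snd q)) (tele s')
  end.

(** The additional coordinate supplies the rank one term by which the kernel of [tele] falls short
    of [wker]. *)
Definition wvec (s : word) : vec (unit + word * X * I) := vsum [(wprod f s, tt)] (tele s).

Variable theta : R.
Hypothesis Htheta : (0 <= theta)%R.
Hypothesis Hf : forall g, g <> gone G -> (Cmod (f g) <= 1)%R.
Hypothesis Ha : forall g, g <> gone G -> exists n, vnorm2 (a g) n /\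
  (n <= (1 - Cmod (f g) * Cmod (f g)) * (1 + theta))%R.

Lemma wprod_le_one s : nontrivial s -> (Cmod (wprod f s) <= 1)%R.
Proof.
  induction s as [|[x g] s IH]; intros Hs; simpl.
  - rewrite Cmod_1; lra.
  - rewrite Cmod_mult. rewrite <- (Rmult_1_l 1).
    apply Rmult_le_compat; auto using Cmod_ge_0.
    + apply Hf. apply (Hs (x, g)). now left.
    + apply IH. intros p Hp. apply Hs. now right.
Qed.

(** With [c] the modulus at the first syllable and [w] that of the remaining product, the new part
    contributes [w^2 (1 - c^2)] and the old one [1 - w^2], up to the factor [1 + theta]. The sum is
    [1 - (c w)^2]. *)
Lemma tele_norm s : nontrivial s -> exists n, vnorm2 (tele s) n /\
  (n <= (1 - Cmod (wprod f s) * Cmod (wprod f s)) * (1 + theta))%R.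
Proof.
  induction s as [|[x g] s IH]; intros Hs.
  - exists 0%R. split; [split; simpl; trivial; lra|]. simpl. rewrite Cmod_1. lra.
  - assert (Hg : g <> gone G) by (apply (Hs (x, g)); now left).
    destruct IH as [n [[Hn Pn] Ln]]; [intros p Hp; apply Hs; now right|].
    destruct (Ha g Hg) as [m [Hm Lm]].
    apply (vnorm2_scal _ (wprod f s)) in Hm as [Hm Pm].
    eexists. split; [split|].
    + cbn [tele]. rewrite vdot_app_l, !vdot_app_r.
      rewrite (vdot_map (fun i => ([], x, i))) by congruence.
      rewrite (vdot_map (fun q => ((x, g) :: fst (fst q), snd (fst q), snd q))).
      2: { intros [[q1 q2] q3] [[r1 r2] r3]; simpl; congruence. }
      rewrite !vdot_map_disjoint by (intros; intros E; congruence).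
      rewrite Hm, Hn, Cplus_0_l, Cplus_0_r, <- RtoC_plus. reflexivity.
    + lra.
    + cbn [wprod]. rewrite Cmod_mult.
      set (w := Cmod (wprod f s)) in *. set (c := Cmod (f g)) in *.
      assert (w * w * m <= w * w * ((1 - c * c) * (1 + theta)))%R
        by (apply Rmult_le_compat_l; [apply Rle_0_sqr|trivial]).
      nra.
Qed.

Lemma wvec_norm s : nontrivial s -> exists n, vnorm2 (wvec s) n /\ (n <= 1 + theta)%R.
Proof.
  intros Hs. destruct (tele_norm s Hs) as [n [Hn Ln]]. eexists. split.
  - apply vnorm2_vsum; [apply vnorm2_single|exact Hn].
  - pose proof (wprod_le_one s Hs). pose proof (Cmod_ge_0 (wprod f s)). nra.
Qed.

End Telescope.

Section Kernel.
Variable psi : G -> C.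
Local Notation psiV := (fun g => psi (ginv G g)).

(* [wker s t] is the product of [psi] over the syllables of [t^-1 s]. *)
Fixpoint wker (s t : word) : C :=
  match s with
  | [] => wprod psiV t
  | (x, g) :: s' =>
      match t with
      | [] => wprod psi s
      | (y, h) :: t' =>
          if excluded_middle_informative (x = y) then
            if excluded_middle_informative (g = h) then wker s' t'
            else psi (gmul G (ginv G h) g) * wprod psi s' * wprod psiV t'
          else wprod psi s * wprod psiV t
      end
  end.

Lemma wker_nil_r s : wker s [] = wprod psi s.
Proof. now destruct s as [|[x g] s]. Qed.

Lemma conj_wprod (f : G -> C) s : Cconj (wprod (fun g => Cconj (f g)) s) = wprod f s.
Proof.
  induction s as [|[x g] s IH]; simpl; [apply conj_RtoC|].
  now rewrite Cmult_conj, Cconj_conj, IH.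
Qed.

Section Factor.
Variables (I : Type) (a b : G -> vec I) (t0 theta : R).
Hypothesis SM : split_multiplier G I psi a b t0 theta.
Local Notation psiV' := (fun g => Cconj (psi (ginv G g))).

(** A common first syllable [g] contributes [1 - psi g psi (g^-1)] times the products over the
    tails, which cancels against the term subtracted in the induction hypothesis. At the first
    difference the centred kernel appears if the labels agree, and 0 otherwise. *)
Lemma tele_dot s t : nontrivial s -> nontrivial t ->
  vdot (tele I psi a s) (tele I psiV' b t) = wker s t - wprod psi s * wprod psiV t.
Proof.
  revert t; induction s as [|[x g] s IH]; intros [|[y h] t] Hs Ht.
  - simpl. ring.
  - simpl. ring.
  - cbn [tele]; rewrite vdot_nil_r. simpl. ring.
  - assert (Hg : g <> gone G) by (apply (Hs (x, g)); now left).
    assert (Hh : h <> gone G) by (apply (Ht (y, h)); now left).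
    cbn [tele]. rewrite vdot_app_l, !vdot_app_r.
    rewrite (vdot_map_disjoint (fun i => ([], x, i))
      (fun q => ((y, h) :: fst (fst q), snd (fst q), snd q))) by (intros; congruence).
    rewrite (vdot_map_disjoint (fun q => ((x, g) :: fst (fst q), snd (fst q), snd q))
      (fun i => ([], y, i))) by (intros; congruence).
    cbn [wker]. destruct (excluded_middle_informative (x = y)) as [<-|Hxy].
    + rewrite (vdot_map (fun i => ([], x, i))) by congruence.
      rewrite vdot_scal_l, vdot_scal_r, (sm_kernel _ _ _ _ _ _ _ SM) by trivial.
      rewrite (conj_wprod (fun g => psi (ginv G g))).
      destruct (excluded_middle_informative (g = h)) as [<-|Hgh].
      * rewrite (vdot_map (fun q => ((x, g) :: fst (fst q), snd (fst q), snd q))).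
        2: { intros [[q1 q2] q3] [[r1 r2] r3]; simpl; congruence. }
        rewrite IH by (intros p Hp; (apply Hs; now right) || (apply Ht; now right)).
        rewrite gmulVl, (sm_one _ _ _ _ _ _ _ SM). cbn [wprod]. ring.
      * rewrite vdot_map_disjoint by (intros; congruence). cbn [wprod]. ring.
    + rewrite !vdot_map_disjoint by (intros; congruence). ring.
Qed.

Lemma wvec_dot s t : nontrivial s -> nontrivial t ->
  vdot (wvec I psi a s) (wvec I psiV' b t) = wker s t.
Proof.
  intros Hs Ht. unfold wvec. rewrite vdot_vsum, tele_dot by trivial.
  cbn [vdot vcoef]. rewrite delta_eq, (conj_wprod (fun g => psi (ginv G g))). ring.
Qed.
End Factor.

(** * Reduced words and left multiplication *)

Definition not_head (x : X) (s : word) : Prop :=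
  match s with [] => True | (y, _) :: _ => x <> y end.

(** Normal forms in the free product of copies of [G] indexed by [X]. *)
Fixpoint reduced (s : word) : Prop :=
  match s with
  | [] => True
  | (x, g) :: s' => g <> gone G /\ not_head x s' /\ reduced s'
  end.

Lemma reduced_nontrivial s : reduced s -> nontrivial s.
Proof.
  induction s as [|[x g] s IH]; intros Hs p; simpl; [tauto|].
  destruct Hs as [Hg [_ Hs]]. intros [<-|Hp]; trivial. now apply IH.
Qed.

Definition wcons (x : X) (g : G) (s : word) : word :=
  if excluded_middle_informative (g = gone G) then s else (x, g) :: s.

(** A reduced word becomes one possibly trivial [x]-syllable followed by a word that does not start
    with [x]. In this form [wmul] is left multiplication in the copy of [G] labelled [x], with no
    case distinction for cancellation. *)
Definition wsplit (x : X) (s : word) : G * word :=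
  match s with
  | [] => (gone G, [])
  | (y, h) :: s' => if excluded_middle_informative (y = x) then (h, s') else (gone G, s)
  end.

Definition wmul (x : X) (g : G) (s : word) : word :=
  wcons x (gmul G g (fst (wsplit x s))) (snd (wsplit x s)).

Lemma wcons_one x s : wcons x (gone G) s = s.
Proof. unfold wcons; destruct excluded_middle_informative; congruence. Qed.

Lemma wcons_neq x g s : g <> gone G -> wcons x g s = (x, g) :: s.
Proof. unfold wcons; destruct excluded_middle_informative; congruence. Qed.

Lemma wsplit_not_head x s : not_head x s -> wsplit x s = (gone G, s).
Proof.
  destruct s as [|[y h] s]; simpl; trivial. destruct excluded_middle_informative; congruence.
Qed.

Lemma wsplit_wcons x g s : not_head x s -> wsplit x (wcons x g s) = (g, s).
Proof.
  intros Hs. unfold wcons. destruct excluded_middle_informative as [->|Hg].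
  - now apply wsplit_not_head.
  - simpl. destruct excluded_middle_informative; congruence.
Qed.

Lemma wsplit_spec x s : reduced s ->
  not_head x (snd (wsplit x s)) /\ reduced (snd (wsplit x s)) /\
  wcons x (fst (wsplit x s)) (snd (wsplit x s)) = s.
Proof.
  destruct s as [|[y h] s]; simpl; intros Hs.
  - now rewrite wcons_one.
  - destruct excluded_middle_informative as [->|Hyx]; simpl.
    + destruct Hs as [Hh [Hn Hs]]. rewrite wcons_neq by trivial. auto.
    + rewrite wcons_one. auto.
Qed.

Lemma wcons_reduced x g s : not_head x s -> reduced s -> reduced (wcons x g s).
Proof.
  intros Hx Hs. unfold wcons. destruct excluded_middle_informative; simpl; auto.
Qed.

Lemma wmul_reduced x g s : reduced s -> reduced (wmul x g s).
Proof. intros Hs. destruct (wsplit_spec x s Hs) as [? [? ?]]. now apply wcons_reduced. Qed.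

Lemma wmul_one x s : reduced s -> wmul x (gone G) s = s.
Proof. intros Hs. unfold wmul. rewrite gmul1l. now apply wsplit_spec. Qed.

Lemma wmul_mul x g h s : reduced s -> wmul x (gmul G g h) s = wmul x g (wmul x h s).
Proof.
  intros Hs. destruct (wsplit_spec x s Hs) as [Hn _]. unfold wmul.
  rewrite wsplit_wcons by trivial. simpl. now rewrite gmulA.
Qed.

Lemma wmul_not_head x g s : not_head x s -> g <> gone G -> wmul x g s = (x, g) :: s.
Proof.
  intros Hx Hg. unfold wmul. rewrite wsplit_not_head by trivial. simpl.
  rewrite gmul1r. now apply wcons_neq.
Qed.

Hypothesis psi1 : psi (gone G) = RtoC 1.

Lemma wker_not_head x g s t : not_head x t ->
  wker ((x, g) :: s) t = wprod psi ((x, g) :: s) * wprod psiV t.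
Proof.
  intros Ht. destruct t as [|[y h] t]; simpl; [ring|].
  simpl in Ht. destruct excluded_middle_informative; [congruence|ring].
Qed.

Lemma wker_not_head_l x h s t : not_head x s ->
  wker s ((x, h) :: t) = wprod psi s * wprod psiV ((x, h) :: t).
Proof.
  intros Hs. destruct s as [|[y g] s]; simpl; [ring|].
  simpl in Hs. destruct excluded_middle_informative; [congruence|ring].
Qed.

(** If exactly one of the two syllables is trivial, [psi (h^-1 g)] reduces to [psi g] or
    [psi (h^-1)], and the value for words with different heads takes the same shape. *)
Lemma wker_wcons x g h s t : not_head x s -> not_head x t ->
  wker (wcons x g s) (wcons x h t) =
  if excluded_middle_informative (g = h) then wker s t
  else psi (gmul G (ginv G h) g) * wprod psi s * wprod psiV t.
Proof.
  intros Hs Ht. unfold wcons.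
  destruct (excluded_middle_informative (g = gone G)) as [->|Hg],
    (excluded_middle_informative (h = gone G)) as [->|Hh].
  - now destruct excluded_middle_informative.
  - rewrite wker_not_head_l by trivial. destruct excluded_middle_informative; [congruence|].
    rewrite gmul1r. simpl. ring.
  - rewrite wker_not_head by trivial. destruct excluded_middle_informative; [congruence|].
    rewrite ginv_one, gmul1l. simpl. ring.
  - simpl. destruct (excluded_middle_informative (x = x)); [reflexivity|congruence].
Qed.

(** Left translation of both leading [x]-syllables preserves whether they are equal, as well as
    their quotient, and the kernel depends on them in no other way. *)
Lemma wker_wmul x g s t : reduced s -> reduced t -> wker (wmul x g s) (wmul x g t) = wker s t.
Proof.
  intros Hs Ht. destruct (wsplit_spec x s Hs) as [Ns [_ Es]], (wsplit_spec x t Ht) as [Nt [_ Et]].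
  rewrite <- Es, <- Et at 2. unfold wmul. rewrite !wker_wcons by trivial.
  rewrite gdiv_translate.
  do 2 destruct excluded_middle_informative; trivial.
  - exfalso. eauto using gmul_cancel.
  - congruence.
Qed.

End Kernel.

(** * Relabelling of syllables *)

Definition wmap (sg : X -> X) (s : word) : word := map (fun p => (sg (fst p), snd p)) s.

Lemma wmap_cons sg x g s : wmap sg ((x, g) :: s) = (sg x, g) :: wmap sg s.
Proof. reflexivity. Qed.

Lemma wprod_wmap sg f s : wprod f (wmap sg s) = wprod f s.
Proof.
  induction s as [|[x g] s IH]; trivial. rewrite wmap_cons. cbn [wprod]. now rewrite IH.
Qed.

Section Injective.
Variable sg : X -> X.
Hypothesis Hsg : forall x y, sg x = sg y -> x = y.

Lemma wker_wmap psi s t : wker psi (wmap sg s) (wmap sg t) = wker psi s t.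
Proof.
  revert t; induction s as [|[x g] s IH]; intros t.
  - apply wprod_wmap.
  - destruct t as [|[y h] t]; [apply (wprod_wmap sg psi ((x, g) :: s))|].
    rewrite !wmap_cons. cbn [wker]. rewrite IH, <- !wmap_cons, !wprod_wmap.
    destruct (excluded_middle_informative (sg x = sg y)),
      (excluded_middle_informative (x = y)); trivial.
    + exfalso; auto.
    + congruence.
Qed.

Lemma not_head_wmap x s : not_head x s -> not_head (sg x) (wmap sg s).
Proof. destruct s as [|[y h] s]; simpl; auto. Qed.

Lemma wmap_reduced s : reduced s -> reduced (wmap sg s).
Proof.
  induction s as [|[x g] s IH]; trivial. rewrite wmap_cons. simpl. intros [Hg [Hx Hs]].
  auto using not_head_wmap.
Qed.

Lemma wmap_wmul x g s : sg x = x -> wmap sg (wmul x g s) = wmul x g (wmap sg s).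
Proof.
  intros Hx. assert (Hc : forall g s, wmap sg (wcons x g s) = wcons x g (wmap sg s)).
  { intros g' s'. unfold wcons. destruct excluded_middle_informative; trivial.
    now rewrite wmap_cons, Hx. }
  unfold wmul. rewrite Hc. destruct s as [|[y h] s]; trivial.
  rewrite wmap_cons. simpl.
  do 2 destruct excluded_middle_informative; simpl; trivial.
  - congruence.
  - exfalso. apply n, Hsg. congruence.
Qed.
End Injective.

Lemma wmap_wmap sg sg' s : wmap sg (wmap sg' s) = wmap (fun x => sg (sg' x)) s.
Proof. unfold wmap. now rewrite map_map. Qed.

Lemma wmap_id sg s : (forall x, sg x = x) -> wmap sg s = s.
Proof.
  intros H. induction s as [|[x g] s IH]; trivial. now rewrite wmap_cons, H, IH.
Qed.

End Words.

(** * The action of a graph product on words *)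

Record perm (W : Type) := Perm {
  papp :> W -> W;
  pinv : W -> W;
  pappK : forall x, papp (pinv x) = x;
  pinvK : forall x, pinv (papp x) = x }.
Arguments papp {W}. Arguments pinv {W}.

Lemma perm_ext {W : Type} (p q : perm W) : (forall x, p x = q x) -> p = q.
Proof.
  destruct p as [p p' H1 H2], q as [q q' H3 H4]; simpl; intros E.
  apply functional_extensionality in E. subst q.
  assert (E : p' = q') by (apply functional_extensionality; intros x; now rewrite <- (H3 x) at 1).
  subst q'. f_equal; apply proof_irrelevance.
Qed.

Definition perm_group (W : Type) : group.
Proof.
  refine (Group (perm W)
    (fun p q => Perm W (fun x => p (q x)) (fun x => pinv q (pinv p x)) _ _)
    (Perm W (fun x => x) (fun x => x) (fun _ => eq_refl) (fun _ => eq_refl))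
    (fun p => Perm W (pinv p) p (pinvK W p) (pappK W p)) _ _ _ _ _);
  intros; try apply perm_ext; simpl; intros; rewrite ?pappK, ?pinvK; trivial.
  Unshelve. all: intros; now rewrite ?pappK, ?pinvK.
Defined.

Section GraphProduct.
Variables (V : Type) (adj : V -> V -> Prop) (Gs : V -> group) (P : group)
  (iota : forall v, Gs v -> P).
Hypothesis Hadj : simplicial V adj.
Hypothesis HP : is_graph_product V adj Gs P iota.

Local Notation letter := {w : V & Gs w}.
Local Notation lt w q := (existT (fun w => gcar (Gs w)) w q).

Fixpoint leval (l : list letter) : P :=
  match l with
  | [] => gone P
  | c :: l' => gmul P (iota (projT1 c) (projT2 c)) (leval l')
  end.

Lemma iota_hom w : is_hom (Gs w) P (iota w).
Proof. apply HP. Qed.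

Lemma leval_app l l' : leval (l ++ l') = gmul P (leval l) (leval l').
Proof.
  induction l as [|c l IH]; simpl; [now rewrite gmul1l|]. now rewrite IH, gmulA.
Qed.

Lemma leval_inv l : exists l', leval l' = ginv P (leval l).
Proof.
  induction l as [|[w q] l [l' IH]]; [exists []; now rewrite ginv_one|].
  exists (l' ++ [lt w (ginv (Gs w) q)]). rewrite leval_app, IH. simpl.
  rewrite gmul1r, ginvM. f_equal. apply hom_inv, iota_hom.
Qed.

Definition generated : group.
Proof.
  refine (Group {x : P | exists l, leval l = x}
    (fun x y => exist _ (gmul P (proj1_sig x) (proj1_sig y)) _)
    (exist _ (gone P) (ex_intro _ [] eq_refl))
    (fun x => exist _ (ginv P (proj1_sig x)) _) _ _ _ _ _);
  intros; repeat match goal with x : {_ | _} |- _ => destruct x end;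
  try apply eq_sig_hprop; simpl; try (intros; apply proof_irrelevance);
  rewrite ?gmulA, ?gmul1l, ?gmul1r, ?gmulVl, ?gmulVr; trivial.
  Unshelve.
  - destruct x as [x [l Hl]], y as [y [l' Hl']]. exists (l ++ l'). simpl. now rewrite leval_app, Hl, Hl'.
  - destruct x as [x [l Hl]]. simpl. rewrite <- Hl. apply leval_inv.
Defined.

(* The universal property splits the inclusion of the generated subgroup. *)
Lemma leval_surjective (g : P) : exists l, leval l = g.
Proof.
  destruct HP as [[Hh Hc] Hu].
  set (i := fun w (q : Gs w) => exist (fun x => exists l, leval l = x) (iota w q)
              (ex_intro _ [lt w q] (gmul1r P _)) : generated).
  destruct (Hu generated i) as [[F [HF HFi]] _].
  { split.
    - intros w x y. apply eq_sig_hprop; [intros; apply proof_irrelevance|apply Hh].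
    - intros w w' x y Hww. apply eq_sig_hprop; [intros; apply proof_irrelevance|].
      now apply Hc. }
  destruct (Hu P iota (conj Hh Hc)) as [_ Huniq].
  assert (E : proj1_sig (F g) = g).
  { apply (Huniq (fun x => proj1_sig (F x)) (fun x => x)); trivial.
    - intros x y. now rewrite HF.
    - intros x y. reflexivity.
    - intros w q. now rewrite HFi. }
  rewrite <- E. apply (proj2_sig (F g)).
Qed.

(** * Words of minimal length and their letters at [v] *)

Definition minimal (l : list letter) : Prop :=
  forall l', leval l' = leval l -> (length l <= length l')%nat.

Lemma exists_minimal (g : P) : exists l, leval l = g /\ minimal l.
Proof.
  destruct (leval_surjective g) as [l Hl].
  remember (length l) as n eqn:Hn. revert l Hl Hn.
  induction n as [n IH] using (well_founded_induction Wf_nat.lt_wf); intros l Hl Hn.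
  destruct (classic (minimal l)) as [Hm|Hm]; [eauto|].
  apply not_all_ex_not in Hm as [l' Hl'].
  apply imply_to_and in Hl' as [E Hlen].
  apply (IH (length l')) with l'; trivial; [lia|congruence].
Qed.

Lemma minimal_tail c l : minimal (c :: l) -> minimal l.
Proof.
  intros H l' E. specialize (H (c :: l')). simpl in H. rewrite E in H.
  specialize (H eq_refl). lia.
Qed.

Lemma minimal_letter l w q : minimal l -> In (lt w q) l -> q <> gone (Gs w).
Proof.
  intros Hm Hin ->. apply in_split in Hin as [l1 [l2 ->]].
  specialize (Hm (l1 ++ l2)). rewrite !leval_app in Hm. simpl in Hm.
  rewrite hom_one, gmul1l in Hm by apply iota_hom.
  specialize (Hm eq_refl). rewrite !length_app in Hm. simpl in Hm. lia.
Qed.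

Variable v : V.

Definition vcast {w : V} (E : w = v) (q : Gs w) : Gs v := eq_rect w (fun w => gcar (Gs w)) q v E.

Fixpoint vletters (l : list letter) : list (Gs v) :=
  match l with
  | [] => []
  | c :: l' =>
      match excluded_middle_informative (projT1 c = v) with
      | left E => vcast E (projT2 c) :: vletters l'
      | right _ => vletters l'
      end
  end.

Lemma vletters_cons_eq q l : vletters (lt v q :: l) = q :: vletters l.
Proof.
  simpl. destruct excluded_middle_informative as [E|]; [|congruence].
  now rewrite (proof_irrelevance _ E eq_refl).
Qed.

Lemma vletters_cons_neq w q l : w <> v -> vletters (lt w q :: l) = vletters l.
Proof. intros Hw. simpl. now destruct excluded_middle_informative. Qed.

Lemma vletters_in l q : In q (vletters l) <-> In (lt v q) l.
Proof.
  induction l as [|[w x] l IH]; [simpl; tauto|].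
  destruct (classic (w = v)) as [->|Hw].
  - rewrite vletters_cons_eq. simpl. rewrite IH. split; intros [E|]; auto; left.
    + now subst.
    + now apply ProofIrrelevanceTheory.EqdepTheory.inj_pair2 in E.
  - rewrite vletters_cons_neq, IH by trivial. simpl. split; auto.
    intros [E|]; trivial. now apply (f_equal (@projT1 _ _)) in E.
Qed.

(* [rho] retracts [P] onto the subgroup of the link of [v]; words have syllables
   indexed by translates of that subgroup (as boolean predicates on [P]). *)
Variable rho : P -> P.
Hypothesis rho_hom : is_hom P P rho.
Hypothesis rho_adj : forall w q, adj v w -> rho (iota w q) = iota w q.
Hypothesis rho_nadj : forall w q, ~ adj v w -> rho (iota w q) = gone P.

Local Notation X := (P -> bool).
Local Notation word := (list (X * Gs v)).

(** As [rho] is a retraction, its fixed points are exactly the link subgroup. *)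
Definition base : X := fun y => if excluded_middle_informative (rho y = y) then true else false.

Definition transl (p : P) (x : X) : X := fun y => x (gmul P (ginv P p) y).

Lemma transl_one x : transl (gone P) x = x.
Proof. apply functional_extensionality. intros y. unfold transl. now rewrite ginv_one, gmul1l. Qed.

Lemma transl_mul p q x : transl (gmul P p q) x = transl p (transl q x).
Proof. apply functional_extensionality. intros y. unfold transl. now rewrite ginvM, gmulA. Qed.

Lemma transl_inj p x y : transl p x = transl p y -> x = y.
Proof.
  intros E. apply (f_equal (transl (ginv P p))) in E.
  now rewrite <- !transl_mul, gmulVl, !transl_one in E.
Qed.

(** The link subgroup is the stabilizer of itself under translation; evaluation at [p] gives the
    forward direction. *)
Lemma transl_base p : transl p base = base <-> rho p = p.
Proof.
  split.
  - intros E. apply (f_equal (fun x => x p)) in E. unfold transl, base in E.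
    rewrite gmulVl, hom_one in E by trivial.
    do 2 destruct excluded_middle_informative; congruence.
  - intros E. apply functional_extensionality. intros y. unfold transl, base.
    destruct (excluded_middle_informative (rho (gmul P (ginv P p) y) = _)) as [H|H],
      (excluded_middle_informative (rho y = y)) as [K|K]; trivial; exfalso.
    + apply K. rewrite <- (gmulKV P p y) at 1. now rewrite rho_hom, E, H, gmulKV.
    + apply H. now rewrite rho_hom, hom_inv, E, K by trivial.
Qed.

Definition rword := {s : word | reduced (Gs v) X s}.

Lemma rword_ext (s t : rword) : proj1_sig s = proj1_sig t -> s = t.
Proof. apply eq_sig_hprop. intros; apply proof_irrelevance. Qed.

Definition mul_rword (g : Gs v) (s : rword) : rword :=
  exist _ _ (wmul_reduced (Gs v) X base g _ (proj2_sig s)).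

Definition transl_rword (p : P) (s : rword) : rword :=
  exist _ _ (wmap_reduced (Gs v) X _ (transl_inj p) _ (proj2_sig s)).

Lemma mul_rword_one s : mul_rword (gone _) s = s.
Proof. apply rword_ext. simpl. apply wmul_one, (proj2_sig s). Qed.

Lemma mul_rword_mul g h s : mul_rword (gmul _ g h) s = mul_rword g (mul_rword h s).
Proof. apply rword_ext. simpl. apply wmul_mul, (proj2_sig s). Qed.

Lemma transl_rword_one s : transl_rword (gone P) s = s.
Proof. apply rword_ext. simpl. apply wmap_id, transl_one. Qed.

Lemma transl_rword_mul p q s : transl_rword (gmul P p q) s = transl_rword p (transl_rword q s).
Proof.
  apply rword_ext. simpl. rewrite wmap_wmap. f_equal.
  apply functional_extensionality. intros x; apply transl_mul.
Qed.

Definition mul_perm (g : Gs v) : perm rword.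
Proof.
  refine (Perm _ (mul_rword g) (mul_rword (ginv _ g)) _ _);
    intros s; now rewrite <- mul_rword_mul, ?gmulVr, ?gmulVl, mul_rword_one.
Defined.

Definition transl_perm (p : P) : perm rword.
Proof.
  refine (Perm _ (transl_rword p) (transl_rword (ginv _ p)) _ _);
    intros s; now rewrite <- transl_rword_mul, ?gmulVr, ?gmulVl, transl_rword_one.
Defined.

(** Modelled on the action of the graph product on the normal closure of the vertex group at [v], a
    free product of conjugates of that group: letters at [v] multiply from the left, the others act
    by conjugation and so permute the labels. *)
Definition letter_perm (w : V) (q : Gs w) : perm rword :=
  match excluded_middle_informative (w = v) with
  | left E => mul_perm (vcast E q)
  | right _ => transl_perm (iota w q)
  end.

Lemma letter_perm_eq q : letter_perm v q = mul_perm q.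
Proof.
  unfold letter_perm. destruct excluded_middle_informative as [E|]; [|congruence].
  now rewrite (proof_irrelevance _ E eq_refl).
Qed.

Lemma letter_perm_neq w q : w <> v -> letter_perm w q = transl_perm (iota w q).
Proof. intros Hw. unfold letter_perm. now destruct excluded_middle_informative. Qed.

Lemma mul_transl_comm w (g : Gs v) (q : Gs w) s : adj v w ->
  mul_rword g (transl_rword (iota w q) s) = transl_rword (iota w q) (mul_rword g s).
Proof.
  intros Hw. apply rword_ext. simpl. symmetry. apply wmap_wmul.
  - apply transl_inj.
  - apply transl_base. now apply rho_adj.
Qed.

(** A letter adjacent to [v] fixes the label [base], so its relabelling commutes with multiplication
    in that copy. Adjacent letters away from [v] commute in [P] already, hence so do their
    translations. *)
Lemma letter_perm_compatible :
  compatible_family V adj Gs (perm_group rword) letter_perm.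
Proof.
  destruct Hadj as [Hsym Hirr]. split.
  - intros w x y. apply perm_ext. intros s. simpl.
    destruct (classic (w = v)) as [->|Hw].
    + rewrite !letter_perm_eq. apply mul_rword_mul.
    + rewrite !letter_perm_neq by trivial. simpl. rewrite (iota_hom w). apply transl_rword_mul.
  - intros w w' x y Hww. apply perm_ext. intros s. simpl.
    destruct (classic (w = v)) as [->|Hw], (classic (w' = v)) as [->|Hw'].
    + now apply Hirr in Hww.
    + rewrite letter_perm_eq, (letter_perm_neq w') by trivial. now apply mul_transl_comm.
    + rewrite letter_perm_eq, (letter_perm_neq w) by trivial. symmetry. apply mul_transl_comm; auto.
    + rewrite !letter_perm_neq by trivial. simpl. rewrite <- !transl_rword_mul. f_equal.
      now apply HP.
Qed.

(** * Orbit of the empty word and the invariant kernel *)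

Variable act : P -> perm rword.
Hypothesis act_hom : is_hom P (perm_group rword) act.
Hypothesis act_iota : forall w q, act (iota w q) = letter_perm w q.

(** The word of [v]-syllables of [g]. Being an orbit map, it depends on the group element alone and
    not on a word for it. *)
Definition orb (g : P) : word := proj1_sig (act g (exist _ [] I)).

Lemma orb_reduced g : reduced (Gs v) X (orb g).
Proof. unfold orb. apply (proj2_sig (act g _)). Qed.

Lemma act_mul p q s : act (gmul P p q) s = act p (act q s).
Proof. now rewrite act_hom. Qed.

Lemma orb_one : orb (gone P) = [].
Proof. unfold orb. now rewrite (hom_one _ _ _ act_hom). Qed.

Lemma orb_letter_eq q g : orb (gmul P (iota v q) g) = wmul (Gs v) X base q (orb g).
Proof. unfold orb. now rewrite act_mul, act_iota, letter_perm_eq. Qed.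

Lemma orb_letter_neq w q g : w <> v ->
  orb (gmul P (iota w q) g) = wmap (Gs v) X (transl (iota w q)) (orb g).
Proof. intros Hw. unfold orb. now rewrite act_mul, act_iota, letter_perm_neq. Qed.

Lemma wker_act (psi : Gs v -> C) g h k : psi (gone _) = RtoC 1 ->
  wker (Gs v) X psi (orb (gmul P k g)) (orb (gmul P k h)) = wker (Gs v) X psi (orb g) (orb h).
Proof.
  intros H1. destruct (leval_surjective k) as [l <-].
  induction l as [|[w q] l IH]; simpl; [now rewrite !gmul1l|].
  rewrite <- !gmulA, <- IH. destruct (classic (w = v)) as [->|Hw].
  - rewrite !orb_letter_eq. apply wker_wmul; trivial; apply orb_reduced.
  - rewrite !orb_letter_neq by trivial. apply wker_wmap, transl_inj.
Qed.

(** Translation by [h^-1] carries the second orbit word to the empty word, where the kernel is the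
    product over the first. *)
Lemma wker_orb (psi : Gs v -> C) g h : psi (gone _) = RtoC 1 ->
  wprod (Gs v) X psi (orb (gmul P (ginv P h) g)) = wker (Gs v) X psi (orb g) (orb h).
Proof.
  intros H1. rewrite <- wker_nil_r, <- orb_one, <- (gmulVl P h). now apply wker_act.
Qed.

Definition link_letters (l : list letter) : list letter :=
  filter (fun c => if excluded_middle_informative (adj v (projT1 c)) then true else false) l.

Lemma leval_link_letters l : leval (link_letters l) = rho (leval l).
Proof.
  induction l as [|[w q] l IH]; simpl; [now rewrite hom_one|].
  rewrite rho_hom, <- IH. destruct excluded_middle_informative as [Hw|Hw]; simpl in *.
  - now rewrite rho_adj.
  - now rewrite rho_nadj, gmul1l.
Qed.

Lemma link_letters_length l : (length (link_letters l) <= length l)%nat /\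
  ((length l <= length (link_letters l))%nat -> forall w q, In (lt w q) l -> adj v w).
Proof.
  induction l as [|c l [IH1 IH2]]; [simpl; split; [lia|tauto]|].
  simpl. destruct excluded_middle_informative as [Hw|Hw]; simpl; split; try lia.
  intros Hl w q [->|Hin]; [exact Hw|]. apply (IH2 ltac:(lia) w q Hin).
Qed.

Lemma leval_link_comm l q : (forall w x, In (lt w x) l -> adj v w) ->
  gmul P (iota v q) (leval l) = gmul P (leval l) (iota v q).
Proof.
  induction l as [|[w x] l IH]; intros Hl; simpl; [now rewrite gmul1l, gmul1r|].
  rewrite gmulA. destruct HP as [[_ Hc] _]. rewrite Hc by (apply (Hl w x); now left).
  rewrite <- !gmulA. f_equal. apply IH. intros w' x' Hin. apply (Hl w' x'). now right.
Qed.

Lemma minimal_infix l1 l2 l3 : minimal (l1 ++ l2 ++ l3) -> minimal l2.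
Proof.
  intros Hm l E. specialize (Hm (l1 ++ l ++ l3)). rewrite !leval_app, E in Hm.
  specialize (Hm eq_refl). rewrite !length_app in Hm. lia.
Qed.

(* Two [v]-letters separated by an element of the link subgroup could be merged. *)
Lemma minimal_separated a u b l :
  minimal (lt v a :: u ++ lt v b :: l) -> transl (leval u) base <> base.
Proof.
  intros Hm E. apply transl_base in E.
  assert (Hu : minimal u).
  { apply (minimal_infix [lt v a] u (lt v b :: l)). exact Hm. }
  (* Deleting the letters of [u] outside the link replaces its value by the image under [rho], which
     is the same element. By minimality of [u] there was nothing to delete. *)
  assert (Hlink : forall w x, In (lt w x) u -> adj v w).
  { apply link_letters_length. apply Hu. now rewrite leval_link_letters. }
  specialize (Hm (u ++ lt v (gmul _ a b) :: l)).
  simpl in Hm. rewrite !leval_app in Hm. simpl in Hm.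
  rewrite (iota_hom v), !gmulA, leval_link_comm in Hm by trivial. specialize (Hm eq_refl).
  rewrite !length_app in Hm. simpl in Hm. lia.
Qed.

(** The second claim carries the induction: it finds the head syllable inside [l], so that
    [minimal_separated] rules out a merger when a further [v]-letter is put in front. *)
Lemma orb_minimal l : minimal l ->
  map snd (orb (leval l)) = vletters l /\
  forall x b s, orb (leval l) = (x, b) :: s ->
    exists u l', l = u ++ lt v b :: l' /\ x = transl (leval u) base.
Proof.
  induction l as [|[w q] l IH]; intros Hm.
  - simpl. rewrite orb_one. split; [trivial|discriminate].
  - destruct (IH (minimal_tail _ _ Hm)) as [IH1 IH2]. cbn [leval projT1 projT2].
    destruct (classic (w = v)) as [->|Hw].
    + rewrite orb_letter_eq, vletters_cons_eq, wmul_not_head.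
      * simpl. rewrite IH1. split; trivial. intros x b s E. injection E as <- <- _.
        exists [], l. split; trivial. now rewrite transl_one.
      * destruct (orb (leval l)) as [|[x b] s]; simpl; trivial.
        destruct (IH2 x b s eq_refl) as [u [l' [-> ->]]]. intros E.
        exact (minimal_separated _ _ _ _ Hm (eq_sym E)).
      * apply (minimal_letter _ _ _ Hm). now left.
    + rewrite orb_letter_neq, vletters_cons_neq by trivial. split.
      * unfold wmap. rewrite map_map. exact IH1.
      * intros x b s E. destruct (orb (leval l)) as [|[x' b'] s'] eqn:E'; [discriminate|].
        rewrite wmap_cons in E. injection E as <- -> _.
        destruct (IH2 x' b s' eq_refl) as [u [l' [-> ->]]].
        exists (lt w q :: u), l'. split; trivial. simpl. now rewrite transl_mul.
Qed.

End GraphProduct.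

(** * Multipliers of the graph product *)

(** A factorization through finite vectors over any index type. Pointwise products then correspond
    to tensor products of vectors, and a Hilbert space is needed only for the final function. *)
Definition B2_vec (G : group) (phi : G -> C) (M : R) : Prop :=
  exists (J : Type) (A B : G -> vec J),
    (forall g, exists n, vnorm2 (A g) n /\ (n <= M)%R) /\
    (forall g, exists n, vnorm2 (B g) n /\ (n <= M)%R) /\
    (forall g h, phi (gmul G (ginv G h) g) = vdot (A g) (B h)).

Definition cprod {T : Type} (f : T -> C) (l : list T) : C :=
  fold_right (fun x z => f x * z) (RtoC 1) l.

Lemma wprod_cprod (G : group) (X : Type) (f : G -> C) s :
  wprod G X f s = cprod f (map snd s).
Proof. induction s as [|[x g] s IH]; simpl; [|rewrite IH]; reflexivity. Qed.

Lemma B2_vec_cprod (G : group) (T : Type) (f : T -> G -> C) (M : R) (l : list T) :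
  (0 <= M)%R -> (forall v, B2_vec G (f v) M) ->
  B2_vec G (fun g => cprod (fun v => f v g) l) (M ^ length l).
Proof.
  intros HM Hf. induction l as [|v l [J [A [B [HA [HB HK]]]]]].
  - exists unit, (fun _ => [(RtoC 1, tt)]), (fun _ => [(RtoC 1, tt)]).
    assert (Hn : exists n, vnorm2 [(RtoC 1, tt)] n /\ (n <= M ^ length (@nil T))%R).
    { eexists. split; [apply vnorm2_single|]. rewrite Cmod_1. simpl. lra. }
    repeat split; trivial. intros g h. simpl. rewrite delta_eq, conj_RtoC. ring.
  - destruct (Hf v) as [J' [A' [B' [HA' [HB' HK']]]]].
    assert (Ht : forall (x : vec J') (y : vec J),
      (exists n, vnorm2 x n /\ (n <= M)%R) -> (exists n, vnorm2 y n /\ (n <= M ^ length l)%R) ->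
      exists n, vnorm2 (vtens x y) n /\ (n <= M ^ length (v :: l))%R).
    { intros x y [n [Hn Ln]] [m [Hm Lm]]. exists (n * m)%R. split; [now apply vnorm2_tens|].
      simpl. apply Rmult_le_compat; trivial; [apply Hn|apply Hm]. }
    exists (J' * J)%type, (fun g => vtens (A' g) (A g)), (fun g => vtens (B' g) (B g)).
    repeat split; auto. intros g h. simpl. now rewrite vdot_tens, <- HK, <- HK'.
Qed.

Lemma vertex_multiplier (V : Type) (adj : V -> V -> Prop) (Gs : V -> group) (P : group)
  (iota : forall v, Gs v -> P) (v : V) (I : Type) (psi : Gs v -> C) (a b : Gs v -> vec I)
  (t theta : R) :
  simplicial V adj -> is_graph_product V adj Gs P iota -> (0 <= theta)%R ->
  split_multiplier (Gs v) I psi a b t theta ->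
  exists f : P -> C, B2_vec P f (1 + theta) /\
    forall l, minimal V Gs P iota l -> f (leval V Gs P iota l) = cprod psi (vletters V Gs v l).
Proof.
  intros Hadj HP Hth SM.
  assert (Hrho : exists rho : P -> P, is_hom P P rho /\
    (forall w q, adj v w -> rho (iota w q) = iota w q) /\
    (forall w q, ~ adj v w -> rho (iota w q) = gone P)).
  { destruct HP as [[Hh Hc] Hu].
    (* The retraction is induced by keeping the vertex groups in the link of [v] and killing all
       others. *)
    destruct (Hu P (fun w q => if excluded_middle_informative (adj v w) then iota w q else gone P))
      as [[rho [Hrho Hi]] _].
    - split.
      + intros w x y. destruct excluded_middle_informative; [apply Hh|now rewrite gmul1l].
      + intros w w' x y Hww. do 2 destruct excluded_middle_informative;
          rewrite ?gmul1l, ?gmul1r; auto.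
    - exists rho. split; trivial. split; intros w q Hw; rewrite Hi;
        destruct excluded_middle_informative; tauto. }
  destruct Hrho as [rho [Hrho [Hr1 Hr2]]].
  pose proof (letter_perm_compatible V adj Gs P iota Hadj HP v rho Hrho Hr1) as Hcomp.
  destruct (proj2 HP _ _ Hcomp) as [[act [Hact Hai]] _].
  set (o := orb V Gs P v act).
  assert (Ho : forall g, nontrivial (Gs v) (P -> bool) (o g))
    by (intros; apply reduced_nontrivial, orb_reduced).
  exists (fun g => wprod (Gs v) (P -> bool) psi (o g)). split.
  (* The second vector uses the conjugate of [psi] at inverses, since [vdot] conjugates its second
     argument and the kernel evaluates the second word at inverses. *)
  - exists _, (fun g => wvec (Gs v) (P -> bool) I psi a (o g)),
      (fun g => wvec (Gs v) (P -> bool) I (fun g => Cconj (psi (ginv _ g))) b (o g)).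
    pose proof (sm_t _ _ _ _ _ _ _ SM) as Ht.
    assert (Hinv : forall g, g <> gone (Gs v) -> ginv _ g <> gone (Gs v))
      by (intros g Hg E; now apply Hg, ginv_eq_one).
    repeat split.
    + intros g. apply wvec_norm; trivial; [|apply (sm_norm_a _ _ _ _ _ _ _ SM)].
      intros x Hx. pose proof (sm_bound _ _ _ _ _ _ _ SM x Hx). lra.
    + intros g. apply wvec_norm; trivial; intros x Hx; rewrite Cmod_conj.
      * pose proof (sm_bound _ _ _ _ _ _ _ SM _ (Hinv x Hx)). lra.
      * now apply (sm_norm_b _ _ _ _ _ _ _ SM).
    + intros g h. erewrite wvec_dot by eauto.
      apply (wker_orb V adj Gs P iota HP v rho); trivial. apply (sm_one _ _ _ _ _ _ _ SM).
  - intros l Hl. rewrite wprod_cprod. f_equal.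
    now apply (orb_minimal V adj Gs P iota HP v rho Hrho Hr1 Hr2 act Hact Hai).
Qed.

(** * Estimates for products, and finiteness of bounded sets of words *)

Lemma pow_one_plus_le (x : R) n : (0 <= x <= 1)%R -> ((1 + x) ^ n <= 1 + 3 ^ n * x)%R.
Proof.
  intros Hx. induction n as [|n IH]; simpl; [lra|].
  assert (1 <= 3 ^ n)%R by (apply pow_R1_Rle; lra).
  (* With [y = 3 ^ n], the product exceeds 1 by [x], [y x] and [y x^2], each at most [y x]; this is
     where the base 3 comes from. *)
  apply Rle_trans with ((1 + x) * (1 + 3 ^ n * x))%R; [apply Rmult_le_compat_l; lra|].
  set (y := (3 ^ n)%R) in *.
  assert (y * x * x <= y * x)%R by (rewrite <- (Rmult_1_r (y * x)) at 2; apply Rmult_le_compat_l; nra).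
  assert (x <= y * x)%R by nra. lra.
Qed.

Lemma cprod_near_one {T : Type} (f : T -> C) (l : list T) (x : R) : (0 <= x)%R ->
  (forall y, In y l -> (Cmod (f y - RtoC 1) <= x)%R) ->
  (Cmod (cprod f l - RtoC 1) <= (1 + x) ^ length l - 1)%R.
Proof.
  intros Hx. induction l as [|y l IH]; intros Hl; simpl.
  - replace (RtoC 1 - RtoC 1) with (RtoC 0) by ring. rewrite Cmod_0. lra.
  - fold (cprod f l). specialize (IH (fun z Hz => Hl z (or_intror Hz))).
    specialize (Hl y (or_introl eq_refl)). set (p := cprod f l) in *.
    replace (f y * p - RtoC 1) with
      ((f y - RtoC 1) * (p - RtoC 1) + ((f y - RtoC 1) + (p - RtoC 1))) by ring.
    eapply Rle_trans; [apply Cmod_triangle|]. rewrite Cmod_mult.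
    pose proof (Cmod_triangle (f y - RtoC 1) (p - RtoC 1)).
    pose proof (Cmod_ge_0 (f y - RtoC 1)). pose proof (Cmod_ge_0 (p - RtoC 1)).
    assert (Cmod (f y - RtoC 1) * Cmod (p - RtoC 1) <= x * ((1 + x) ^ length l - 1))%R
      by now apply Rmult_le_compat.
    lra.
Qed.

Lemma cprod_le_one {T : Type} (f : T -> C) (l : list T) :
  (forall y, In y l -> (Cmod (f y) <= 1)%R) -> (Cmod (cprod f l) <= 1)%R.
Proof.
  induction l as [|y l IH]; intros Hl; simpl; [rewrite Cmod_1; lra|].
  rewrite Cmod_mult. rewrite <- (Rmult_1_l 1).
  apply Rmult_le_compat; auto using Cmod_ge_0.
  - apply Hl; now left.
  - apply IH. intros; apply Hl; now right.
Qed.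

Lemma cprod_le_factor {T : Type} (f : T -> C) (l : list T) x :
  (forall y, In y l -> (Cmod (f y) <= 1)%R) -> In x l -> (Cmod (cprod f l) <= Cmod (f x))%R.
Proof.
  induction l as [|y l IH]; [easy|]. intros Hl [->|Hx]; simpl; rewrite Cmod_mult; fold (cprod f l).
  - pose proof (cprod_le_one f l (fun z Hz => Hl z (or_intror Hz))).
    pose proof (Cmod_ge_0 (f x)). nra.
  - specialize (IH (fun z Hz => Hl z (or_intror Hz)) Hx).
    pose proof (Hl y (or_introl eq_refl)). pose proof (Cmod_ge_0 (f y)).
    pose proof (Cmod_ge_0 (cprod f l)). nra.
Qed.

Lemma cprod_le_pow {T : Type} (f : T -> C) (l : list T) t : (0 <= t)%R ->
  (forall y, In y l -> (Cmod (f y) <= t)%R) -> (Cmod (cprod f l) <= t ^ length l)%R.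
Proof.
  intros Ht. induction l as [|y l IH]; intros Hl; simpl; [rewrite Cmod_1; lra|].
  rewrite Cmod_mult. apply Rmult_le_compat; auto using Cmod_ge_0.
  - apply Hl; now left.
  - apply IH. intros; apply Hl; now right.
Qed.

Fixpoint words_upto {T : Type} (n : nat) (alph : list T) : list (list T) :=
  [] :: match n with
        | O => []
        | S m => flat_map (fun w => map (fun c => c :: w) alph) (words_upto m alph)
        end.

Lemma in_words_upto {T : Type} n (alph l : list T) :
  (length l <= n)%nat -> (forall c, In c l -> In c alph) -> In l (words_upto n alph).
Proof.
  revert l; induction n as [|n IH]; intros [|c l]; simpl; intros Hlen Hl; auto; [lia|].
  right. apply in_flat_map. exists l. split; [apply IH; [lia|auto]|].
  apply (in_map (fun c => c :: l)). auto.
Qed.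

(** Each letter is counted at its own vertex. Since [vs] may repeat vertices, there is only an
    inequality. *)
Lemma length_le_sum_vletters (V : Type) (Gs : V -> group) (vs : list V) (l : list {w : V & Gs w}) :
  (forall v, In v vs) -> (length l <= list_sum (map (fun v => length (vletters V Gs v l)) vs))%nat.
Proof.
  intros Hvs. induction l as [|[w q] l IH]; [simpl; lia|].
  assert (Hs : forall us, (list_sum (map (fun v => length (vletters V Gs v l)) us) <=
    list_sum (map (fun v => length (vletters V Gs v (existT _ w q :: l))) us))%nat /\
    (In w us -> list_sum (map (fun v => length (vletters V Gs v l)) us) <
    list_sum (map (fun v => length (vletters V Gs v (existT _ w q :: l))) us))%nat).
  { induction us as [|u us [IH1 IH2]]; [simpl; split; [lia|tauto]|].
    cbn [map list_sum fold_right].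
    fold (list_sum (map (fun v => length (vletters V Gs v l)) us)).
    fold (list_sum (map (fun v => length (vletters V Gs v (existT _ w q :: l))) us)).
    destruct (classic (w = u)) as [->|Hw].
    - rewrite vletters_cons_eq. cbn [length]. split; lia.
    - rewrite vletters_cons_neq by trivial. split; [lia|].
      intros [E|Hin]; [congruence|]. specialize (IH2 Hin). lia. }
  simpl length at 1. pose proof (proj2 (Hs vs) (Hvs w)). lia.
Qed.

Lemma dependent_choice {V : Type} {T : V -> Type} (Q : forall v, T v -> Prop) :
  (forall v, exists x, Q v x) -> exists f : forall v, T v, forall v, Q v (f v).
Proof.
  intros H. exists (fun v => proj1_sig (constructive_indefinite_description _ (H v))).
  intros v. apply (proj2_sig (constructive_indefinite_description _ (H v))).
Qed.

Lemma list_sum_map_le {T : Type} (f g : T -> nat) l :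
  (forall x, f x <= g x)%nat -> (list_sum (map f l) <= list_sum (map g l))%nat.
Proof. intros H. induction l as [|x l IH]; simpl; [lia|]. specialize (H x). unfold list_sum in *. lia. Qed.

Lemma graph_product_countable (V : Type) (adj : V -> V -> Prop) (Gs : V -> group)
  (P : group) (iota : forall v, Gs v -> P) :
  finite_type V -> is_graph_product V adj Gs P iota ->
  (forall v, countable (Gs v)) -> countable P.
Proof.
  intros HV HP Hc. apply (countable_image (leval V Gs P iota)).
  - apply (leval_surjective V adj Gs P iota HP).
  - now apply countable_list, countable_sigma.
Qed.

(** For decay at infinity, each syllable costs a factor [t v < 1], so a value of modulus at least
    [eps] limits the number of syllables at every vertex. Decay of [psi v] confines each of these
    syllables to a finite set. *)
Lemma graph_product_locally_WH1 (V : Type) (adj : V -> V -> Prop) (Gs : V -> group)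
  (P : group) (iota : forall v, Gs v -> P) :
  finite_type V -> simplicial V adj -> is_graph_product V adj Gs P iota ->
  (forall v, countable (Gs v)) -> (forall v, locally_WH1 (Gs v)) -> locally_WH1 P.
Proof.
  intros HV Hadj HP Hcount HWH F theta0 Hth0.
  pose proof (graph_product_countable _ _ _ _ _ HV HP Hcount) as HcP.
  destruct HV as [vs Hvs].
  set (theta := Rmin theta0 1).
  assert (Hth : (0 < theta <= 1)%R) by (split; [apply Rmin_glb_lt; lra|apply Rmin_r]).
  assert (Hth' : (theta <= theta0)%R) by apply Rmin_l.
  destruct (choice _ (exists_minimal V adj Gs P iota HP)) as [wd Hwd].
  set (n2 := list_sum (map (fun g => length (wd g)) F)).
  (* [N] dominates both exponents that occur: [length vs] for the norm of the product, and
     [n2 * length vs] for its values on [F]. The choice of [x] then keeps [(1 + x) ^ N] below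
     [1 + theta / 2]. *)
  set (N := (length vs * n2 + length vs)%nat).
  set (x := (theta / (2 * 3 ^ N))%R).
  assert (H3 : (1 <= 3 ^ N)%R) by (apply pow_R1_Rle; lra).
  assert (Hx3 : (3 ^ N * x = theta / 2)%R) by (unfold x; field; lra).
  assert (Hx : (0 < x <= 1)%R) by (split; [apply Rdiv_lt_0_compat; lra|nra]).
  assert (Hpow : forall n, (n <= N)%nat -> ((1 + x) ^ n <= 1 + theta / 2)%R).
  { intros n Hn. eapply Rle_trans; [apply pow_one_plus_le; lra|]. rewrite <- Hx3.
    apply Rplus_le_compat_l, Rmult_le_compat_r; [lra|]. apply Rle_pow; [lra|trivial]. }
  assert (Hdata : forall v, exists d : (Gs v -> C) * (P -> C) * R,
    let '(psi, f, t) := d in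
    vanishes_at_infinity (Gs v) psi /\
    (forall g, In g F -> forall q, In q (vletters V Gs v (wd g)) ->
       (Cmod (psi q - RtoC 1) <= x)%R) /\
    (0 <= t < 1)%R /\ (forall q, q <> gone _ -> (Cmod (psi q) <= t)%R) /\
    B2_vec P f (1 + x) /\
    (forall g, f g = cprod psi (vletters V Gs v (wd g)))).
  { intros v.
    destruct (exists_split_multiplier (Gs v) (Hcount v) (HWH v)
      (flat_map (fun g => vletters V Gs v (wd g)) F) x Hx)
      as [psi [I [a [b [t [Hv [HF SM]]]]]]].
    destruct (vertex_multiplier V adj Gs P iota v I psi a b t x Hadj HP) as [f [Hf1 Hf2]];
      [lra|trivial|].
    exists (psi, f, t). split; [trivial|]. split; [|split; [|split; [|split]]]; trivial.
    - intros g Hg q Hq. apply Rlt_le, HF, in_flat_map. eauto.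
    - apply (sm_t _ _ _ _ _ _ _ SM).
    - apply (sm_bound _ _ _ _ _ _ _ SM).
    - intros g. destruct (Hwd g) as [E Hm]. rewrite <- Hf2, E by trivial. reflexivity. }
  apply dependent_choice in Hdata as [d Hd].
  set (psi := fun v => fst (fst (d v))). set (f := fun v => snd (fst (d v))).
  set (t := fun v => snd (d v)).
  assert (Hd' : forall v,
    vanishes_at_infinity (Gs v) (psi v) /\
    (forall g, In g F -> forall q, In q (vletters V Gs v (wd g)) ->
       (Cmod (psi v q - RtoC 1) <= x)%R) /\
    (0 <= t v < 1)%R /\ (forall q, q <> gone _ -> (Cmod (psi v q) <= t v)%R) /\
    B2_vec P (f v) (1 + x) /\
    (forall g, f v g = cprod (psi v) (vletters V Gs v (wd g)))).
  { intros v. specialize (Hd v). unfold psi, f, t. now destruct (d v) as [[? ?] ?]. }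
  clear Hd. clearbody psi f t.
  assert (Hlet : forall v g q, In q (vletters V Gs v (wd g)) -> (Cmod (psi v q) <= t v)%R).
  { intros v g q Hq. destruct (Hd' v) as [_ [_ [_ [Hb _]]]]. apply Hb.
    destruct (Hwd g) as [_ Hm]. apply (minimal_letter V adj Gs P iota HP (wd g)); trivial.
    now apply vletters_in. }
  assert (Hlet1 : forall v g q, In q (vletters V Gs v (wd g)) -> (Cmod (psi v q) <= 1)%R).
  { intros v g q Hq. specialize (Hlet v g q Hq). destruct (Hd' v) as [_ [_ [Ht _]]]. lra. }
  assert (Hf1 : forall v g, (Cmod (f v g) <= 1)%R).
  { intros v g. destruct (Hd' v) as [_ [_ [_ [_ [_ ->]]]]]. apply cprod_le_one. apply Hlet1. }
  (* A vertex repeated in [vs] repeats its factor, which the estimates in terms of [length vs] allow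
     for. *)
  exists (fun g => cprod (fun v => f v g) vs). split; [|split].
  - intros eps He.
    assert (Hlst : forall v, exists ln : list (Gs v) * nat, forall g,
      (eps <= Cmod (cprod (fun v => f v g) vs))%R ->
      (length (vletters V Gs v (wd g)) <= snd ln)%nat /\
      (forall q, In q (vletters V Gs v (wd g)) -> In q (fst ln))).
    { intros v. destruct (Hd' v) as [Hv [_ [Ht [_ [_ Hfv]]]]].
      destruct (Hv eps He) as [l Hl].
      destruct (pow_lt_1_zero (t v)) with eps as [n Hn]; trivial.
      { rewrite Rabs_pos_eq; lra. }
      exists (l, n). intros g Hg.
      (* All factors have modulus at most 1, so a large product forces each single factor to be
         large. *)
      assert (Hfe : (eps <= Cmod (f v g))%R).
      { eapply Rle_trans; [exact Hg|]. apply (cprod_le_factor (fun v => f v g)); auto. }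
      rewrite Hfv in Hfe. split.
      - simpl. destruct (Compare_dec.le_lt_dec (length (vletters V Gs v (wd g))) n) as [|Hlt]; trivial.
        exfalso. assert (Hge : (length (vletters V Gs v (wd g)) >= n)%nat) by lia.
        specialize (Hn _ Hge). rewrite Rabs_pos_eq in Hn by (apply pow_le; lra).
        pose proof (cprod_le_pow (psi v) (vletters V Gs v (wd g)) (t v) (proj1 Ht) (Hlet v g)).
        lra.
      - intros q Hq. apply Hl. eapply Rle_trans; [exact Hfe|].
        apply cprod_le_factor; trivial. apply Hlet1. }
    apply dependent_choice in Hlst as [ln Hln].
    exists (map (leval V Gs P iota) (words_upto (list_sum (map (fun v => snd (ln v)) vs))
      (flat_map (fun v => map (fun q => existT (fun w => gcar (Gs w)) v q) (fst (ln v))) vs))).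
    intros g Hg. destruct (Hwd g) as [E _]. rewrite <- E. apply in_map, in_words_upto.
    + eapply Nat.le_trans; [apply (length_le_sum_vletters V Gs vs); trivial|].
      apply list_sum_map_le. intros v. now apply Hln.
    + intros [v q] Hin. apply in_flat_map. exists v. split; trivial.
      apply (in_map (fun q => existT (fun w => gcar (Gs w)) v q)).
      apply (Hln v g Hg). now apply vletters_in.
  - destruct (B2_vec_cprod P V f (1 + x) vs) as [J [A [B [HA [HB HK]]]]].
    + lra.
    + intros v. apply Hd'.
    + assert (Hle : ((1 + x) ^ length vs <= 1 + theta0)%R).
      { eapply Rle_trans; [apply Hpow; unfold N; lia|]. lra. }
      apply (B2_le_of_vec P J _ A B); trivial; try lra.
      * intros g. destruct (HA g) as [n [Hn Ln]]. exists n. split; [trivial|lra].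
      * intros g. destruct (HB g) as [n [Hn Ln]]. exists n. split; [trivial|lra].
  - intros g Hg.
    assert (Hn2 : forall v, (length (vletters V Gs v (wd g)) <= n2)%nat).
    { intros v. apply Nat.le_trans with (length (wd g)).
      - clear. induction (wd g) as [|[w q] l IH]; [simpl; lia|].
        destruct (classic (w = v)) as [->|Hw];
          [rewrite vletters_cons_eq|rewrite vletters_cons_neq by trivial]; simpl length; lia.
      - unfold n2. clear - Hg. induction F as [|h F IH]; [easy|]. simpl.
        destruct Hg as [->|Hg]; [lia|]. specialize (IH Hg). unfold list_sum in *. lia. }
    assert (Hfn : forall v, In v vs -> (Cmod (f v g - RtoC 1) <= (1 + x) ^ n2 - 1)%R).
    { intros v _. destruct (Hd' v) as [_ [Hnear [_ [_ [_ ->]]]]].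
      eapply Rle_trans; [apply (cprod_near_one _ _ x); [lra|now apply Hnear]|].
      apply Rplus_le_compat_r, Rle_pow; [lra|apply Hn2]. }
    assert (H1p : (1 <= (1 + x) ^ n2)%R) by (apply pow_R1_Rle; lra).
    eapply Rle_lt_trans; [apply (cprod_near_one (fun v => f v g) vs ((1 + x) ^ n2 - 1)%R); [lra|exact Hfn]|].
    replace (1 + ((1 + x) ^ n2 - 1))%R with ((1 + x) ^ n2)%R by ring.
    rewrite <- pow_mult. specialize (Hpow (n2 * length vs)%nat).
    assert (n2 * length vs <= N)%nat by (unfold N; lia). specialize (Hpow H). lra.
Qed.

(** * The value of the weak Haagerup constant *)

Lemma WH_constant_one (G : group) : countable G -> locally_WH1 G -> WH_constant G 1.
Proof.
  intros Hc HG. split; [lra|].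
  destruct (countable_enum (gone G) Hc) as [e He].
  set (th := fun n => (/ INR (S n))%R).
  assert (Hth : forall n, (0 < th n)%R) by (intros; apply Rinv_0_lt_compat, lt_0_INR; lia).
  assert (Hex := fun n => HG (map e (seq 0 (S n))) (th n) (Hth n)).
  apply choice in Hex as [phi Hphi].
  (* Division by [1 + th n] lowers the norm bound to exactly 1 and, as [th n] tends to 0, keeps the
     pointwise limit. *)
  exists (fun n g => RtoC (/ (1 + th n)) * phi n g).
  assert (Hk : forall n, (0 < / (1 + th n) <= 1)%R).
  { intros n. specialize (Hth n). split; [apply Rinv_0_lt_compat; lra|].
    rewrite <- Rinv_1. apply Rinv_le_contravar; lra. }
  assert (Hkm : forall n, Cmod (RtoC (/ (1 + th n))) = (/ (1 + th n))%R).
  { intros n. rewrite Cmod_R. apply Rabs_pos_eq. specialize (Hk n). lra. }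
  split; [|split].
  - intros n eps Heps. destruct (Hphi n) as [Hv _]. destruct (Hv eps Heps) as [l Hl].
    exists l. intros g Hg. apply Hl. rewrite Cmod_mult, Hkm in Hg.
    specialize (Hk n). pose proof (Cmod_ge_0 (phi n g)). nra.
  - intros g eps Heps. destruct (He g) as [k Hkg].
    (* One half of [eps] is for the distance of [phi n g] from 1, the other for the error of the
       rescaling. *)
    destruct (archimed_cor1 (eps / 2)) as [N [HN HN0]]; [lra|].
    exists (Nat.max k N). intros n Hn. destruct (Hphi n) as [_ [_ Hnear]].
    assert (Hg : In g (map e (seq 0 (S n)))).
    { rewrite <- Hkg. apply in_map, in_seq. lia. }
    specialize (Hnear g Hg). specialize (Hth n). specialize (Hk n).
    assert (Hthn : (th n < eps / 2)%R).
    { eapply Rle_lt_trans; [|exact HN]. apply Rinv_le_contravar; [apply lt_0_INR; lia|].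
      apply le_INR. lia. }
    change (Cmod (RtoC (/ (1 + th n)) * phi n g - RtoC 1) < eps)%R.
    replace (RtoC (/ (1 + th n)) * phi n g - RtoC 1) with
      (RtoC (/ (1 + th n)) * ((phi n g - RtoC 1) + RtoC (- th n))).
    + rewrite Cmod_mult, Hkm.
      pose proof (Cmod_triangle (phi n g - RtoC 1) (RtoC (- th n))) as T.
      rewrite Cmod_R, Rabs_Ropp, (Rabs_pos_eq (th n)) in T by lra.
      pose proof (Cmod_ge_0 (phi n g - RtoC 1 + RtoC (- th n))). nra.
    + transitivity (RtoC (/ (1 + th n)) * phi n g - RtoC (/ (1 + th n) * (1 + th n))).
      * rewrite RtoC_mult, RtoC_plus, RtoC_opp. ring.
      * rewrite Rinv_l by lra. reflexivity.
  - intros n eps Heps. destruct (Hphi n) as [_ [HB _]].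
    destruct (HB eps Heps) as [H [al [be [Ma [Mb [HMa [HMb [HM HK]]]]]]]].
    specialize (Hth n). specialize (Hk n).
    exists H, (fun g => hscal H (RtoC (/ (1 + th n))) (al g)), be, (/ (1 + th n) * Ma)%R, Mb.
    split; [|split; [|split]]; trivial.
    + intros g. unfold hnorm. rewrite Re_hinner_scal, Hkm.
      rewrite sqrt_mult, sqrt_square; try nra; [|apply hinner_pos].
      apply Rmult_le_compat_l; [lra|]. apply HMa.
    + apply Rle_trans with (/ (1 + th n) * (1 + th n + eps))%R.
      * rewrite Rmult_assoc. apply Rmult_le_compat_l; lra.
      * rewrite Rmult_plus_distr_l, Rinv_l by lra. nra.
    + intros g h. now rewrite hinnerZl, <- HK.
Qed.

(** By Cauchy-Schwarz the multiplier norm dominates the modulus of the value at the identity, and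
    these values tend to 1. *)
Lemma WH_constant_ge_one (G : group) B : WH_constant G B -> (1 <= B)%R.
Proof.
  intros [_ [phi [_ [Hlim HB]]]]. destruct (Rle_lt_dec 1 B) as [|Hlt]; trivial. exfalso.
  (* One third of the gap is lost to the slack in [B2_le] and one to the distance of the value from
     1, which leaves [1 < B + 2 (1 - B) / 3], a contradiction. *)
  assert (He : (0 < (1 - B) / 3)%R) by lra.
  destruct (Hlim (gone G) _ He) as [N HN]. specialize (HN N (le_n N)).
  destruct (HB N _ He) as [H [al [be [Ma [Mb [HMa [HMb [HM HK]]]]]]]].
  pose proof (Cmod_hinner_le H _ _ Ma Mb (HMa (gone G)) (HMb (gone G))) as Hle.
  rewrite <- HK, gmulVl in Hle. set (c := phi N (gone G)) in *.
  pose proof (Cmod_triangle c (- (c + - RtoC 1))) as T. rewrite Cmod_opp in T.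
  replace (c + - (c + - RtoC 1)) with (RtoC 1) in T by ring. rewrite Cmod_1 in T. lra.
Qed.

Theorem theorem1 (V : Type) (adj : V -> V -> Prop) (Gs : V -> group)
  (P : group) (iota : forall v, Gs v -> P) :
  finite_type V -> simplicial V adj ->
  (forall v, finitely_generated (Gs v)) ->
  (forall v, weak_Haagerup (Gs v) /\ Lambda_WH_eq (Gs v) 1%R) ->
  is_graph_product V adj Gs P iota ->
  weak_Haagerup P /\ Lambda_WH_eq P 1%R.
Proof.
  intros HV Hadj Hfg HWH HP.
  assert (Hcount : forall v, countable (Gs v)) by (intros; now apply countable_finitely_generated).
  assert (H1 : WH_constant P 1).
  { apply WH_constant_one; [now apply (graph_product_countable V adj Gs P iota)|].
    apply (graph_product_locally_WH1 V adj Gs P iota); trivial.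
    intros v. apply locally_WH1_of_Lambda, HWH. }
  assert (HW : weak_Haagerup P) by now exists 1%R.
  split; trivial. split; [|split]; trivial.
  - intros B. apply WH_constant_ge_one.
  - auto.
Qed.
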